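(* Let $m,n\in\mathbb N$, $\phi=m/n$, and let $\Sigma\in\mathbb R^{n\times n}$ be an invertible covariance matrix. Suppose $1/K\le\phi^{-1}\le K$, $\sigma_\xi^2\in[0,K]$ and $\|\Sigma\|_{\mathrm{op}}\vee\mathcal H_\Sigma\le K$ for some $K>0$. There exists some constant $C=C(K)>0$ such that for any $\epsilon\in(0,1/2]$ there is a measurable set $\mathcal U_\epsilon\subset B_n(1)$ with $\mathrm{vol}(\mathcal U_\epsilon)/\mathrm{vol}(B_n(1))\ge1-C\epsilon^{-1}e^{-n\epsilon^2/C}$ and $$\sup_{\mu_0\in\mathcal U_\epsilon}\sup_{\eta\in\Xi_K}\big|\bar R^{\#}_{(\Sigma,\mu_0)}(\eta)-\mathscr R^{\#}_{(\Sigma,\mu_0)}(\eta)\big|\le\epsilon,\qquad\#\in\{\mathsf{pred},\mathsf{est},\mathsf{in}\}.\qquad(\dagger)$$ Here, with $\mathsf{SNR}_{\mu_0}=\|\mu_0\|^2/\sigma_\xi^2$, $\mathfrak m_\eta\equiv\mathfrak m(-\eta/\phi)$ and $\mathfrak m_\eta'\equiv\mathfrak m'(-\eta/\phi)$, $$\mathscr R^{\mathsf{pred}}_{(\Sigma,\mu_0)}(\eta)=\sigma_\xi^2\Big\{\frac{1}{\mathfrak m_\eta^2}\Big(\phi\,\mathsf{SNR}_{\mu_0}\mathfrak m_\eta-(\eta\,\mathsf{SNR}_{\mu_0}-1)\mathfrak m_\eta'\Big)-1\Big\},$$ $$\mathscr R^{\mathsf{est}}_{(\Sigma,\mu_0)}(\eta)=\sigma_\xi^2\Big\{\mathsf{SNR}_{\mu_0}(1-\phi)+\mathfrak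 m_\eta+\frac\eta\phi(\eta\,\mathsf{SNR}_{\mu_0}-1)\mathfrak m_\eta'\Big\},$$ $$\mathscr R^{\mathsf{in}}_{(\Sigma,\mu_0)}(\eta)=\sigma_\xi^2\,\frac{\eta^2}{\phi}\Big(\phi\,\mathsf{SNR}_{\mu_0}\mathfrak m_\eta-(\eta\,\mathsf{SNR}_{\mu_0}-1)\mathfrak m_\eta'\Big)+\sigma_\xi^2(\phi-2\eta\mathfrak m_\eta).$$ When $\Sigma=I_n$, one may take $\mathcal U_\epsilon=B_n(1)$ and $(\dagger)$ holds with $\epsilon=0$.
   Context: $\|\cdot\|$ is the Euclidean norm, $B_n(R)$ the closed Euclidean ball, $\mathrm{vol}$ Lebesgue measure, $\mathcal H_\Sigma=\operatorname{tr}(\Sigma^{-1})/n$, $a\vee b=\max\{a,b\}$, $\Xi_K\equiv[\mathbf 1_{\phi^{-1}<1+1/K}K^{-1},K]$. When $\sigma_\xi^2=0$, the products $\sigma_\xi^2\,\mathsf{SNR}_{\mu_0}$ are read as $\|\mu_0\|^2$. Effective noise and regularization: with $g\sim\mathcal N(0,I_n)$ and $\hat\mu^{\mathsf{seq}}_{(\Sigma,\mu_0)}(\gamma;\tau)=(\Sigma+\tau I_n)^{-1}\Sigma^{1/2}(\Sigma^{1/2}\mu_0+n^{-1/2}\gamma g)$, $(\gamma_{\eta,\ast},\tau_{\eta,\ast})\in[0,\infty)\times(0,\infty)$ is the unique solution (existing if $\eta>0$, or $\eta=0$ and $m<n$) of $$\phi\gamma^2=\sigma_\xi^2+\mathbb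 E\big\|\Sigma^{1/2}\big(\hat\mu^{\mathsf{seq}}_{(\Sigma,\mu_0)}(\gamma;\tau)-\mu_0\big)\big\|^2,\qquad\phi-\frac\eta\tau=\frac1n\operatorname{tr}\big((\Sigma+\tau I_n)^{-1}\Sigma\big).$$ Theoretical risks: $\bar R^{\mathsf{pred}}_{(\Sigma,\mu_0)}(\eta)=\tau_{\eta,\ast}^2\|(\Sigma+\tau_{\eta,\ast}I_n)^{-1}\Sigma^{1/2}\mu_0\|^2+\frac{\gamma_{\eta,\ast}^2}{n}\operatorname{tr}\big(\Sigma^2(\Sigma+\tau_{\eta,\ast}I_n)^{-2}\big)$; $\bar R^{\mathsf{est}}_{(\Sigma,\mu_0)}(\eta)=\tau_{\eta,\ast}^2\|(\Sigma+\tau_{\eta,\ast}I_n)^{-1}\mu_0\|^2+\frac{\gamma_{\eta,\ast}^2}{n}\operatorname{tr}\big(\Sigma(\Sigma+\tau_{\eta,\ast}I_n)^{-2}\big)$; $\bar R^{\mathsf{in}}_{(\Sigma,\mu_0)}(\eta)=\big(\frac{\eta\gamma_{\eta,\ast}}{\tau_{\eta,\ast}}\big)^2+\phi\sigma_\xi^2\big(1-\frac{2\eta}{\phi\tau_{\eta,\ast}}\big)$. Stieltjes transform: for $z\in\mathbb C$ with $\Im z>0$, $\mathfrak m(z)$ is the unique solution with $\Im\mathfrak m(z)>0$ of $$z=-\frac1{\mathfrak m(z)}+\frac1\phi\cdot\frac1n\operatorname{tr}\big((I_n+\Sigma\,\mathfrak m(z))^{-1}\Sigma\big);$$ it is the Stieltjes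 transform $\mathfrak m(z)=\int\frac{\rho(dx)}{x-z}$ of a probability measure $\rho$ on $[0,\infty)$ (the asymptotic eigenvalue density of $G\Sigma G^\top/m$, $G\in\mathbb R^{m\times n}$ with i.i.d. $\mathcal N(0,1)$ entries) and is extended by this formula to real $z$ outside $\mathrm{supp}\,\rho$; this covers $z=-\eta/\phi$ for $\eta>0$, and for $\eta=0$ when $\phi^{-1}>1$. *)

(* Defs.v *)
From HB Require Import structures.
From mathcomp Require Import all_boot all_order all_algebra.
From mathcomp Require Import all_classical all_reals all_analysis.
From mathcomp Require Import complex.

Set Implicit Arguments.
Unset Strict Implicit.
Unset Printing Implicit Defensive.

Import Order.TTheory GRing.Theory Num.Theory.
Import numFieldNormedType.Exports.

Local Open Scope classical_set_scope.
Local Open Scope ring_scope.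

Section product_powers.
Context d (T : measurableType d) (R : realType).

Definition tuple_cons n (p : T * n.-tuple T) : n.+1.-tuple T :=
  [tuple of p.1 :: p.2].

Lemma measurable_tuple_cons n : measurable_fun setT (@tuple_cons n).
Proof. exact: measurable_cons. Qed.

Section step.
Variables (n : nat) (mu : {sigma_finite_measure set T -> \bar R})
  (nu : {sigma_finite_measure set (n.-tuple T) -> \bar R}).

Definition tuple_product : set (n.+1.-tuple T) -> \bar R :=
  pushforward (mu \x nu)%E (@tuple_cons n).

Let mf := @measurable_tuple_cons n.

HB.instance Definition _ := Measure.copy tuple_product
  (measure_function_pushforward__canonical__measure_function_Measure
     (mu \x nu)%E mf).

Let sigma_finite_tuple_product : sigma_finite setT tuple_product.
Proof.
have /sigma_finiteP[F [TF ndF Foo]] := sigma_finiteT mu.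
have /sigma_finiteP[G [TG ndG Goo]] := sigma_finiteT nu.
pose g (t : n.+1.-tuple T) := (thead t, [tuple of behead t] : n.-tuple T).
have mg : measurable_fun setT g.
  apply: measurable_fun_pair; first exact: measurable_tnth.
  exact: measurable_behead.
have gK : g \o @tuple_cons n = id.
  apply/funext => -[x t] /=; rewrite /g theadE; congr pair; exact/val_inj.
exists (fun k => g @^-1` (F k `*` G k)).
  apply/esym; rewrite -subTset => t _.
  have [i _ Fi] : (\bigcup_k F k) (thead t) by rewrite -TF.
  have [j _ Gj] : (\bigcup_k G k) [tuple of behead t] by rewrite -TG.
  exists (maxn i j) => //; split => /=.
    by move: Fi; exact/subsetPset/ndF/leq_maxl.
  by move: Gj; exact/subsetPset/ndG/leq_maxr.
move=> k; have [mF Fk] := Foo k; have [mG Gk] := Goo k; split.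
  by rewrite -[X in measurable X]setTI; apply: mg => //; exact: measurableX.
rewrite /tuple_product /pushforward -comp_preimage gK.
by rewrite [X in (X < _)%E]product_measure1E// lte_mul_pinfty// ge0_fin_numE.
Qed.

HB.instance Definition _ := Measure_isSigmaFinite.Build _ _ _ tuple_product
  sigma_finite_tuple_product.

End step.

(* The n-fold product mu (x) ... (x) mu on n-tuples; on the one-point space
   of 0-tuples it is the Dirac mass. *)
Fixpoint product_power (mu : {sigma_finite_measure set T -> \bar R}) (n : nat)
    : {sigma_finite_measure set (n.-tuple T) -> \bar R} :=
  match n with
  | 0 => \d_([tuple] : 0.-tuple T)
  | n'.+1 => tuple_product mu (product_power mu n')
  end.

End product_powers.

Section euclidean_space.
Context {R : realType}.
Implicit Types n : nat.

(* Measure theory on R^n is done on [n.-tuple (measurableTypeR R)], linear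
   algebra on the corresponding column vector. *)
Definition vec n (t : n.-tuple (measurableTypeR R)) : 'cV[R]_n :=
  \col_i (tnth t i : R).

Definition vol n
    : {sigma_finite_measure set (n.-tuple (measurableTypeR R)) -> \bar R} :=
  product_power (@lebesgue_measure R) n.

Definition std_gaussian n
    : {sigma_finite_measure set (n.-tuple (measurableTypeR R)) -> \bar R} :=
  product_power (@normal_prob R 0 1) n.

Definition enorm n (v : 'cV[R]_n) : R := Num.sqrt (\sum_i v i ord0 ^+ 2).

Definition eball n (r : R) : set (n.-tuple (measurableTypeR R)) :=
  [set t | enorm (vec t) <= r].

Definition opnorm n (A : 'M[R]_n) : R :=
  sup [set enorm (A *m x) | x in [set x : 'cV[R]_n | enorm x <= 1]].

Definition psd n (A : 'M[R]_n) : Prop :=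
  A^T = A /\ forall x : 'cV[R]_n, 0 <= (x^T *m A *m x) ord0 ord0.

(* The unique symmetric positive semidefinite square root of a symmetric
   positive semidefinite matrix. *)
Definition sqrtmx n (A : 'M[R]_n) : 'M[R]_n :=
  xget 0 [set Q : 'M[R]_n | psd Q /\ Q *m Q = A].

Definition harmonic_trace n (Sigma : 'M[R]_n) : R :=
  \tr (invmx Sigma) / n%:R.

End euclidean_space.

Inductive risk := RiskPred | RiskEst | RiskIn.

Section risks.
Context {R : realType} (n : nat).
Variables (phi sigma2 : R) (Sigma : 'M[R]_n) (mu0 : 'cV[R]_n).

Definition resolvent (tau : R) : 'M[R]_n := invmx (Sigma + tau%:M).

Definition mu_seq (gamma tau : R) (g : 'cV[R]_n) : 'cV[R]_n :=
  resolvent tau *m sqrtmx Sigma *m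
    (sqrtmx Sigma *m mu0 + ((Num.sqrt n%:R)^-1 * gamma) *: g).

Definition effective_system (eta gamma tau : R) : Prop :=
  [/\ 0 <= gamma,
      0 < tau,
      ((phi * gamma ^+ 2)%:E = sigma2%:E +
        \int[@std_gaussian R n]_g
          (enorm (sqrtmx Sigma *m (mu_seq gamma tau (vec g) - mu0)) ^+ 2)%:E)%E
    & phi - eta / tau = n%:R^-1 * \tr (resolvent tau *m Sigma)].

(* (gamma_{eta,*}, tau_{eta,*}); arbitrary when the system has no solution. *)
Definition effective (eta : R) : R * R :=
  xget (0, 1) [set p : R * R | effective_system eta p.1 p.2].

Definition risk_bar (h : risk) (eta : R) : R :=
  let gamma := (effective eta).1 in
  let tau := (effective eta).2 in
  match h with
  | RiskPred => tau ^+ 2 * enorm (resolvent tau *m sqrtmx Sigma *m mu0) ^+ 2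
      + gamma ^+ 2 / n%:R * \tr (Sigma ^+ 2 *m resolvent tau ^+ 2)
  | RiskEst => tau ^+ 2 * enorm (resolvent tau *m mu0) ^+ 2
      + gamma ^+ 2 / n%:R * \tr (Sigma *m resolvent tau ^+ 2)
  | RiskIn => (eta * gamma / tau) ^+ 2
      + phi * sigma2 * (1 - 2 * eta / (phi * tau))
  end.

End risks.

Section stieltjes.
Context {R : realType}.
Local Open Scope complex_scope.

(* int rho(dx) / (x - z), integrating real and imaginary parts separately. *)
Definition stieltjes (rho : probability (measurableTypeR R) R) (z : R[i])
    : R[i] :=
  (\int[rho]_x complex.Re (((x : R)%:C - z)^-1)) +i*
  (\int[rho]_x complex.Im (((x : R)%:C - z)^-1)).

(* w is a solution in the upper half-plane of the equation defining m(z). *)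
Definition stieltjes_equation n (phi : R) (Sigma : 'M[R]_n) (z w : R[i])
    : Prop :=
  let SigmaC := map_mx (real_complex R) Sigma in
  0 < complex.Im w /\
  z = - w^-1 + (phi^-1)%:C * ((n%:R^-1)%:C *
        \tr (invmx (1%:M + w *: SigmaC) *m SigmaC)).

(* rho is the probability measure on [0, +oo) whose Stieltjes transform is
   m(z); it is determined by its Stieltjes transform, hence unique. *)
Definition spectral_density n (phi : R) (Sigma : 'M[R]_n)
    (rho : probability (measurableTypeR R) R) : Prop :=
  rho `[0, +oo[%classic = 1%E /\
  forall z : R[i], 0 < complex.Im z ->
    stieltjes_equation phi Sigma z (stieltjes rho z).

(* The same formula at a real point outside the support of rho. *)
Definition mreal (rho : probability (measurableTypeR R) R) (z : R) : R :=
  \int[rho]_x ((x : R) - z)^-1.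

(* The risk formulas, with sigma2 * SNR read as `|mu0|^2 throughout (this is
   an identity if sigma2 != 0, and the convention if sigma2 = 0). *)
Definition risk_script n (phi sigma2 : R)
    (rho : probability (measurableTypeR R) R)
    (mu0 : 'cV[R]_n) (h : risk) (eta : R) : R :=
  let s := enorm mu0 ^+ 2 in
  let m := mreal rho (- eta / phi) in
  let m' := derive1 (mreal rho) (- eta / phi) in
  match h with
  | RiskPred => (m ^+ 2)^-1 * (phi * s * m - (eta * s - sigma2) * m') - sigma2
  | RiskEst => s * (1 - phi) + sigma2 * m + eta / phi * (eta * s - sigma2) * m'
  | RiskIn => eta ^+ 2 / phi * (phi * s * m - (eta * s - sigma2) * m')
      + sigma2 * (phi - 2 * eta * m)
  end.

End stieltjes.

Section concentration.
Context {R : realType}.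

Definition Xi (K phi : R) : set R :=
  `[(if phi^-1 < 1 + K^-1 then K^-1 else 0), K].

Definition sup_risk_gap n (K phi sigma2 : R) (Sigma : 'M[R]_n)
    (rho : probability (measurableTypeR R) R)
    (U : set (n.-tuple (measurableTypeR R))) (h : risk) : \bar R :=
  ereal_sup [set ereal_sup
    [set (`|risk_bar phi sigma2 Sigma (vec mu0) h eta
            - risk_script phi sigma2 rho (vec mu0) h eta|)%:E
    | eta in Xi K phi] | mu0 in U].

Definition large_subset n (C eps : R)
    (U : set (n.-tuple (measurableTypeR R))) : Prop :=
  [/\ measurable U,
      U `<=` eball 1
    & 1 - C * eps^-1 * expR (- (n%:R * eps ^+ 2) / C)
        <= fine (vol n U) / fine (vol n (eball 1))].

End concentration.

(* Main.v *)
Require Import Defs.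
From mathcomp Require Import all_boot all_order all_algebra.
From mathcomp Require Import all_classical all_reals all_analysis.
From mathcomp Require Import measurable_realfun complex ring lra.

(** Write Sigma in an eigenbasis, with eigenvalues lam_j, let c_j be the
coordinates of mu0 and avg the mean over j.  The effective noise
gamma and regularization tau solve

   phi - eta / tau = avg (lam / (lam + tau)),    gamma^2 D = sigma2 + A,

with D = phi - avg ((lam / (lam + tau))^2) and
A = sum_j lam_j (tau / (lam_j + tau))^2 c_j^2 ([effective_systemE]).  On the
spectral side, psi (v) = - 1 / v + avg (lam / (1 + lam v)) / phi is the inverse
function of the Stieltjes transform, and the first equation above says exactly
psi (1 / tau) = - eta / phi.  Hence m (- eta / phi) = 1 / tau, and
m' (- eta / phi) = 1 / psi' (1 / tau) = phi / (tau^2 D).  After this substitution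
the spectral formula for each of the three risks is the theoretical risk in which
A, and its analogue B = sum_j (tau / (lam_j + tau))^2 c_j^2, are replaced by
|mu0|^2 times the average of their weights.  Each gap is therefore an explicit
linear combination of the quadratic forms A - |mu0|^2 avg (weights) and
B - |mu0|^2 avg (weights) in mu0 ([pred_gapE], [est_gapE], [in_gapE]), whose
coefficients are bounded in terms of K because tau lies in
[1 / (2 K^2), 2 K^2] and D >= 1 / (18 K^7) ([fixed_point_range], [dof_gap_ge]);
the resulting estimate is [risk_gap].  For Sigma = 1 the weights do not depend on
j and both forms vanish, so the gap is zero.

For general Sigma the two forms are trace-free.  If N is symmetric and
trace-free, the points x of the unit ball with x^T N x > e lie in the ellipsoid
x^T (1 - t N) x <= 1 - t e, whose relative volume
(1 - t e)^(n/2) det (1 - t N)^(-1/2) is exponentially small in n e^2 for a suitable t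
([vol_quadratic_tail]).  The volume of an ellipsoid is computed by induction on
the dimension, completing one square at a time ([integral_qform]).  A union bound
over a grid of values of tau, together with the Lipschitz dependence of the
weights on tau, gives one set of vectors that works for all tau, hence for all eta
([uniform_good_set]).

The values of m and m' at a real point, eta = 0 included, are obtained without
information on the support of rho.  When psi' (v) > 0, comparing the equation
at x + i y and at x = psi (v) gives |m (x + i y) - v| = O(y) ([stability]).  So
Im m (x + i y) / y = int rho(dt) / ((t - x)^2 + y^2) stays bounded as y decreases to
0, hence 1 / (t - x)^2 is rho-integrable, and the real integral of 1 / (t - x) is the
limit v ([mreal_psi]).  As this holds for all v near 1 / tau, the function m is a
local inverse of psi, which gives m' ([derive1_mreal]). *)

Set Implicit Arguments.
Unset Strict Implicit.
Unset Printing Implicit Defensive.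

Import Order.TTheory GRing.Theory Num.Theory.
Import numFieldNormedType.Exports.
Import ComplexField.Normc.

Local Open Scope classical_set_scope.
Local Open Scope ring_scope.

(** * The spectral theorem for real symmetric matrices *)
Section spectral.
Context {R : realType}.

Lemma sum_sqr_gt0 (I : finType) (f : I -> R) i :
  f i != 0 -> 0 < \sum_i f i ^+ 2.
Proof.
move=> fi; rewrite (bigD1 i)//= ltr_wpDr ?exprn_even_gt0//.
by apply: sumr_ge0 => l _; exact: sqr_ge0.
Qed.

(** Over the complex numbers the matrix is Hermitian, hence unitarily
diagonalizable with a real diagonal; an entry of the diagonal is a real eigenvalue
already over the reals, since being an eigenvalue is a determinant condition. *)
Lemma symmetric_real_eigenvalue n (A : 'M[R]_n.+1) : A^T = A ->
  exists a : R, eigenvalue A a.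
Proof.
move=> sA; pose AC := map_mx (real_complex R) A.
have hA : AC \is hermsymmx.
  apply: realsym_hermsym.
    by apply/is_hermitianmxP; rewrite expr0 scale1r; apply/matrixP => i j; rewrite !mxE -{1}sA mxE.
  by apply/mxOverP => i j; rewrite mxE; apply/complex_realP; exists (A i j).
have := hermitian_spectral_diag_real hA.
have /hermitian_normalmx /orthomx_spectralP := hA.
set P := spectralmx AC; set d := spectral_diag AC => AE dreal.
have /complex_realP[a da] : d ord0 ord0 \is Num.real.
  by have /mxOverP := dreal; apply.
exists a.
suff : eigenvalue AC (d ord0 ord0) by rewrite da eigenvalue_map.
apply/eigenvalueP; exists (row ord0 P).
  rewrite {1}AE !mulmxA -row_mul mulmxV ?spectral_unit// row1.
  by rewrite -rowE row_diag_mx -scalemxAl -rowE.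
apply/eqP => P0; have := spectral_unit AC.
rewrite -row_free_unit -kermx_eq0 => /eqP ker0.
have /sub_kermxP : delta_mx 0 ord0 *m P = (0 : 'rV_n.+1) by rewrite -rowE.
rewrite ker0 submx0 => /eqP/rowP/(_ ord0); rewrite !mxE !eqxx => /eqP.
by rewrite oner_eq0.
Qed.

(** With e the first basis vector, the reflection in the hyperplane orthogonal to
v - e exchanges e and v.  It is an
orthogonal matrix with prescribed first row, which spares completing v to an
orthonormal basis. *)
Lemma householder n (v : 'rV[R]_n.+1) : v *m v^T = 1%:M ->
  exists H : 'M[R]_n.+1, [/\ H^T = H, H *m H = 1%:M & delta_mx 0 0 *m H = v].
Proof.
move=> v1; pose e : 'rV[R]_n.+1 := delta_mx 0 0.
have [w wE] : exists w : 'rV[R]_n.+1, w = v - e by exists (v - e).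
have [w0|w0] := eqVneq w 0.
  exists 1%:M; rewrite trmx1 !mulmx1; split => //.
  by apply/esym/eqP; rewrite -subr_eq0 -/e -wE w0.
pose q : R := (w *m w^T) 0 0.
have wwE : w *m w^T = q%:M by rewrite [LHS]mx11_scalar.
have qE : q = \sum_i w 0 i ^+ 2.
  by rewrite /q mxE; under eq_bigr do rewrite mxE -expr2.
have q0 : q != 0.
  by have /rV0Pn[i wi] := w0; rewrite qE gt_eqF// (sum_sqr_gt0 wi).
exists (1%:M - (2 / q) *: (w^T *m w)); split.
- by rewrite linearB /= trmx1 linearZ /= trmx_mul trmxK.
- have : (w^T *m w) *m (w^T *m w) = q *: (w^T *m w).
    by rewrite mulmxA -(mulmxA w^T) wwE mul_mx_scalar -scalemxAl.
  move: (w^T *m w) => X XX.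
  rewrite mulmxBl !mulmxBr !mul1mx !mulmx1 -!scalemxAl -!scalemxAr XX.
  by apply/matrixP => i j; rewrite !mxE; field.
- rewrite mulmxBr mulmx1 -scalemxAr mulmxA -/e.
  have ew : e *m w^T = (v 0 0 - 1)%:M.
    rewrite [LHS]mx11_scalar; congr (_%:M).
    by rewrite /e -rowE !mxE wE !mxE eqxx.
  have qv : q = 2 * (1 - v 0 0).
    have ve : v *m e^T = (v 0 0)%:M.
      rewrite [LHS]mx11_scalar; congr (_%:M).
      by rewrite -[v *m _]trmxK trmx_mul trmxK /e -rowE !mxE.
    have : w *m w^T = (2 * (1 - v 0 0))%:M.
      rewrite {1}wE mulmxBl ew wE linearB/= mulmxBr v1 ve.
      by apply/matrixP => i j; rewrite !mxE !ord1 eqxx /=; ring.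
    by move=> /(congr1 (fun M : 'M[R]_1 => M 0 0)); rewrite -/q => ->; rewrite !mxE eqxx.
  rewrite ew mul_scalar_mx scalerA.
  have -> : 2 / q * (v 0 0 - 1) = -1.
    by move: q0; rewrite qv => q0; field; move: q0; rewrite mulf_eq0 negb_or => /andP[].
  by rewrite scaleN1r opprK wE addrC subrK.
Qed.

(** Deflation: a reflection moves a unit eigenvector to the first basis vector,
which makes the conjugated matrix block diagonal with a smaller symmetric block. *)
Lemma real_spectral n (A : 'M[R]_n) : A^T = A ->
  exists (P : 'M[R]_n) (d : 'rV[R]_n),
    P *m P^T = 1%:M /\ A = P^T *m diag_mx d *m P.
Proof.
elim: n A => [|n IH] A sA.
  exists 1%:M, 0; split; first by rewrite trmx1 mulmx1.
  by apply/matrixP => -[].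
have [a /eigenvalueP[v0 v0A v0N]] := symmetric_real_eigenvalue sA.
pose q := \sum_i v0 0 i ^+ 2.
have q_gt0 : 0 < q by have /rV0Pn[i vi] := v0N; exact: (sum_sqr_gt0 vi).
pose v := (Num.sqrt q)^-1 *: v0.
have vA : v *m A = a *: v by rewrite -scalemxAl v0A !scalerA mulrC.
have v1 : v *m v^T = 1%:M.
  rewrite [LHS]mx11_scalar; congr (_%:M); rewrite mxE.
  under eq_bigr do rewrite !mxE mulrACA -expr2 -expr2.
  by rewrite -mulr_sumr -/q exprVn sqr_sqrtr ?(ltW q_gt0)// mulVf// gt_eqF.
have [H [Hs HH He]] := householder v1.
have [B BH] : exists B : 'M[R]_(1 + n), B = H *m A *m H by exists (H *m A *m H).
have sB : B^T = B by rewrite BH !trmx_mul Hs sA mulmxA.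
have eB : delta_mx 0 0 *m B = a *: (delta_mx 0 0 : 'rV[R]_n.+1).
  by rewrite BH !mulmxA He vA -scalemxAl -He -mulmxA HH mulmx1.
have Brow j : B 0 j = a *+ (j == 0).
  have := congr1 (fun M : 'rV[R]_n.+1 => M 0 j) eB.
  by rewrite -rowE /= !mxE eqxx /= mulr_natr.
pose A' : 'M[R]_n := drsubmx B.
have sA' : A'^T = A' by rewrite /A' trmx_drsub sB.
have [P' [d' [P'1 A'E]]] := IH A' sA'.
have BE : B = block_mx a%:M 0 0 A'.
  have ul : ulsubmx B = a%:M.
    apply/matrixP => i j; rewrite !mxE !ord1 eqxx.
    by transitivity (B 0 0); [by congr (B _ _); exact/val_inj | rewrite Brow].
  have ur : ursubmx B = 0.
    apply/matrixP => i j; rewrite !mxE ord1.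
    by transitivity (B 0 (rshift 1 j)); [by congr (B _ _); exact/val_inj | rewrite Brow].
  have dl : dlsubmx B = 0 by rewrite -[LHS]trmxK trmx_dlsub sB ur trmx0.
  by rewrite -[LHS]submxK ul ur dl.
pose Q : 'M[R]_(1 + n) := block_mx 1%:M 0 0 P'.
pose d : 'rV[R]_(1 + n) := row_mx a%:M d'.
have QQ : Q *m Q^T = 1%:M.
  rewrite /Q tr_block_mx mulmx_block !trmx0 !mulmx0 !mul0mx !addr0 !add0r.
  by rewrite trmx1 mulmx1 P'1 -scalar_mx_block.
have BQ : B = Q^T *m diag_mx d *m Q.
  rewrite BE /Q /d diag_mx_row tr_block_mx !mulmx_block.
  rewrite !(trmx0, mulmx0, mul0mx, addr0, add0r, trmx1, mulmx1, mul1mx) -A'E.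
  congr block_mx.
  by apply/matrixP => i j; rewrite !mxE !ord1 eqxx.
exists (Q *m H), d; split.
  by rewrite trmx_mul Hs mulmxA -(mulmxA Q) HH mulmx1.
have -> : A = H *m B *m H.
  by rewrite BH !mulmxA HH mul1mx -mulmxA HH mulmx1.
by rewrite trmx_mul Hs BQ !mulmxA.
Qed.

End spectral.

(** * Integration over product powers and the volume of ellipsoids *)
Section product_power_integral.
Context d (T : measurableType d) (R : realType).
Variables (mu : {sigma_finite_measure set T -> \bar R}) (n : nat).
Variable f : n.+1.-tuple T -> \bar R.
Hypotheses (mf : measurable_fun [set: n.+1.-tuple T] f) (f0 : forall t, (0 <= f t)%E).

Let mfc : measurable_fun setT (f \o @tuple_cons d T n).
Proof. by apply: measurableT_comp => //; exact: measurable_tuple_cons. Qed.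

Let pushE : (\int[product_power mu n.+1]_t f t =
  \int[mu \x (product_power mu n)]_p (f \o @tuple_cons d T n) p)%E.
Proof.
exact: (ge0_integral_pushforward (@measurable_tuple_cons d T n)
  (mu \x (product_power mu n))%E measurableT mf (fun t _ => f0 t)).
Qed.

Lemma integral_product_powerS : (\int[product_power mu n.+1]_t f t =
  \int[mu]_x \int[product_power mu n]_t f (tuple_cons (x, t)))%E.
Proof. by rewrite pushE (fubini_tonelli1 _ mfc)// => p; exact: f0. Qed.

Lemma integral_product_powerS' : (\int[product_power mu n.+1]_t f t =
  \int[product_power mu n]_t \int[mu]_x f (tuple_cons (x, t)))%E.
Proof.
rewrite integral_product_powerS.
exact: (@fubini_tonelli _ _ _ _ _ mu (product_power mu n) _ mfc (fun p => f0 _)).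
Qed.

End product_power_integral.

Section affine.
Context {R : realType}.
Local Notation mu := (@lebesgue_measure R).

(** The right-hand side is a measure with the right values on intervals. *)
Lemma lebesgue_measure_affine (a b : R) : 0 < a ->
  forall A : set (measurableTypeR R), measurable A ->
  mu A = (a%:E * mu ((fun x => a * (x + b))%R @^-1` A))%E.
Proof.
move=> a0 A mA.
have mg : measurable_fun (setT : set (measurableTypeR R))
    (fun x : measurableTypeR R => a * (x + b) : measurableTypeR R).
  by apply: measurable_funM => //; exact: measurable_funD.
pose push := measure_function_pushforward__canonical__measure_function_Measure mu mg.
refine (lebesgue_measure_unique (mu := mscale (NngNum (ltW a0)) push) _ mA).
move=> X [[p q] _ <-] /=.
rewrite /mscale /= /pushforward.
have -> : (fun x : R => a * (x + b)) @^-1` `]p, q] = `]p / a - b, q / a - b]%classic.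
  apply/seteqP; split => x /=; rewrite !in_itv /=;
    rewrite ltrBlDr lerBrDr ltr_pdivrMr// ler_pdivlMr//; by rewrite mulrC.
rewrite !lebesgue_measure_itv /= !lte_fin ltrD2r ltr_pM2r ?invr_gt0//.
case: ifPn => _; last by rewrite mule0.
rewrite -!EFinB -EFinM; congr (_%:E); field; exact: lt0r_neq0.
Qed.

Lemma ge0_integral_affine (a b : R) (g : measurableTypeR R -> \bar R) : 0 < a ->
  measurable_fun setT g -> (forall x, 0 <= g x)%E ->
  (\int[mu]_x g (a * (x + b))%R = (a^-1)%:E * \int[mu]_x g x)%E.
Proof.
move=> a0 mg g0.
have mh : measurable_fun (setT : set (measurableTypeR R))
    (fun x : measurableTypeR R => a * (x + b) : measurableTypeR R).
  by apply: measurable_funM => //; exact: measurable_funD.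
pose push := measure_function_pushforward__canonical__measure_function_Measure mu mh.
have h1 := ge0_integral_pushforward mh mu measurableT mg (fun t _ => g0 t).
have h2 := @ge0_integral_mscale _ _ R push setT measurableT (NngNum (ltW a0)) g mg
  (fun t _ => g0 t).
have -> : (\int[mu]_x g x = \int[mscale (NngNum (ltW a0)) push]_x g x)%E.
  by apply: eq_measure_integral => A mA _; exact: lebesgue_measure_affine.
rewrite h2 h1 /= muleA -EFinM mulVf ?gt_eqF// mul1e.
by apply: eq_integral.
Qed.

End affine.

Section quadratic_form.
Context {R : realType}.
Local Notation RT := (measurableTypeR R).
Local Notation mu := (@lebesgue_measure R).

Definition qform n (M : 'M[R]_n) (x : 'cV[R]_n) : R := (x^T *m M *m x) 0 0.

Definition posdef n (M : 'M[R]_n) : Prop :=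
  M^T = M /\ forall x : 'cV[R]_n, x != 0 -> 0 < qform M x.

Lemma qformE n (M : 'M[R]_n) x :
  qform M x = \sum_j (\sum_i x i 0 * M i j) * x j 0.
Proof.
rewrite /qform mxE; apply: eq_bigr => j _; congr (_ * _).
by rewrite mxE; apply: eq_bigr => i _; rewrite mxE.
Qed.

Lemma qform1 n (x : 'cV[R]_n) : qform 1%:M x = \sum_i x i 0 ^+ 2.
Proof.
by rewrite /qform mulmx1 mxE; apply: eq_bigr => i _; rewrite mxE expr2.
Qed.

Lemma measurable_qform n (M : 'M[R]_n) :
  measurable_fun [set: n.-tuple RT] (fun t => qform M (vec t) : RT).
Proof.
under eq_fun do rewrite qformE.
have mt (i : 'I_n) : measurable_fun [set: n.-tuple RT] (fun t => vec t i 0 : RT).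
  under eq_fun do rewrite mxE.
  exact: measurable_tnth.
apply: measurable_sum => j; apply: measurable_funM; last exact: mt.
by apply: measurable_sum => i; apply: measurable_funM; [exact: mt | exact: measurable_cst].
Qed.

Lemma vec_tuple_cons n (x : R) (t : n.-tuple RT) :
  vec (tuple_cons (x : RT, t)) = col_mx (x%:M : 'M[R]_1) (vec t) :> 'cV[R]_(1 + n).
Proof.
apply/matrixP => i j; rewrite !mxE ord1; case: splitP => k ik.
  rewrite ord1 !mxE eqxx mulr1n (_ : i = ord0) ?tnth0//; apply/val_inj.
  by rewrite /= ik ord1.
rewrite mxE (_ : i = lift ord0 k) ?tnthS//; first exact/val_inj.
Qed.

Lemma qform1_cons n (x : R) (t : n.-tuple RT) :
  qform 1%:M (vec (tuple_cons (x : RT, t))) = x ^+ 2 + qform 1%:M (vec t).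
Proof.
rewrite !qform1 big_ord_recl !mxE tnth0; congr (_ + _).
by apply: eq_bigr => i _; rewrite !mxE tnthS.
Qed.
Definition schur_complement n (M : 'M[R]_(1 + n)) : 'M[R]_n :=
  drsubmx M - (M 0 0)^-1 *: (dlsubmx M *m ursubmx M).

(** Read as a polynomial in the first coordinate; the remainder is the Schur
complement of the first diagonal entry. *)
Lemma complete_square n (M : 'M[R]_(1 + n)) (x : R) (y : 'cV[R]_n) :
  M^T = M -> M 0 0 != 0 ->
  qform M (col_mx x%:M y) =
    M 0 0 * (x + (M 0 0)^-1 * (ursubmx M *m y) 0 0) ^+ 2 +
    qform (schur_complement M) y.
Proof.
move=> sM a0.
have ul : ulsubmx M = (M 0 0)%:M.
  rewrite [LHS]mx11_scalar; congr (_%:M); rewrite !mxE.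
  by congr (M _ _); exact/val_inj.
have dl : dlsubmx M = (ursubmx M)^T by rewrite -{1}sM -trmx_ursub.
rewrite /qform tr_col_mx -{1}(submxK M) mul_row_block mul_row_col ul dl.
rewrite /schur_complement dl tr_scalar_mx.
set a := M 0 0 in a0 *; move: (ursubmx M) (drsubmx M) => u S.
rewrite mulmxBr mulmxBl !mulmxDl -!scalemxAr -!scalemxAl.
rewrite -scalar_mxM !mul_scalar_mx -scalemxAl mulmxA.
have -> : y^T *m u^T = ((u *m y) 0 0)%:M by rewrite -trmx_mul {1}[u *m y]mx11_scalar tr_scalar_mx.
set w := (u *m y) 0 0.
have wE : u *m y = w%:M by rewrite [LHS]mx11_scalar.
rewrite !mul_scalar_mx -scalemxAl wE; move: (y^T *m S *m y) => Z.
by rewrite !mxE eqxx !mulr1n /=; field.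
Qed.

Lemma schur_complement_sym n (M : 'M[R]_(1 + n)) : M^T = M ->
  (schur_complement M)^T = schur_complement M.
Proof.
move=> sM; rewrite /schur_complement linearB /= linearZ /= trmx_mul.
by rewrite trmx_drsub trmx_dlsub trmx_ursub sM.
Qed.

(** One step of block Gaussian elimination. *)
Lemma det_schur_complement n (M : 'M[R]_(1 + n)) : M 0 0 != 0 ->
  \det M = M 0 0 * \det (schur_complement M).
Proof.
move=> a0.
have ul : ulsubmx M = (M 0 0)%:M.
  rewrite [LHS]mx11_scalar; congr (_%:M); rewrite !mxE.
  by congr (M _ _); exact/val_inj.
have ME : M = block_mx 1%:M 0 ((M 0 0)^-1 *: dlsubmx M) 1%:M *m
              block_mx (M 0 0)%:M (ursubmx M) 0 (schur_complement M).
  rewrite -{1}[M]submxK ul mulmx_block !(mul1mx, mul0mx, mulmx0, addr0, add0r).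
  rewrite mul_mx_scalar scalerA divff// scale1r /schur_complement.
  by rewrite -scalemxAl addrC subrK.
by rewrite {1}ME det_mulmx det_lblock det_ublock !det1 !mul1r det_scalar expr1.
Qed.

(** The Schur complement at y is the value of M at (x, y) for the x that
annihilates the completed square. *)
Lemma schur_complement_posdef n (M : 'M[R]_(1 + n)) : posdef M ->
  0 < M 0 0 /\ posdef (schur_complement M).
Proof.
move=> [sM pM].
have a0 : 0 < M 0 0.
  have := pM (delta_mx 0 0); have -> : qform M (delta_mx 0 0) = M 0 0.
    by rewrite /qform trmx_delta -rowE -colE !mxE.
  by apply; apply/eqP => /matrixP/(_ 0 0); rewrite !mxE eqxx => /eqP; rewrite oner_eq0.
split => //; split; first exact: schur_complement_sym.
move=> y y0.
have := pM (col_mx (- ((M 0 0)^-1 * (ursubmx M *m y) 0 0))%:M y).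
rewrite complete_square ?gt_eqF// addNr expr0n mulr0 add0r; apply.
apply: contra y0 => /eqP h; apply/eqP.
by rewrite -[y](col_mxKd (- ((M 0 0)^-1 * (ursubmx M *m y) 0 0))%:M) h linear0.
Qed.

(** The linear substitution formula for functions of a quadratic form.
Completing the square in the first coordinate x and rescaling x gives the factor
(M 0 0)^(-1/2) and the integrand h (x^2 + q), with q the form of the Schur
complement in the other coordinates; for fixed x, the induction hypothesis applies to
y |-> h (x^2 + y), so that h has to vary in the induction. *)
Lemma integral_qform n (M : 'M[R]_n) (h : RT -> \bar R) : posdef M ->
  measurable_fun setT h -> (forall x, 0 <= h x)%E ->
  0 < \det M /\
  (\int[vol n]_t h (qform M (vec t)) =
    ((Num.sqrt (\det M))^-1)%:E * \int[vol n]_t h (qform 1%:M (vec t)))%E.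
Proof.
move=> pM mh h0; elim: n M h pM mh h0 => [|n IH] M h pM mh h0.
  have -> : M = 1%:M by apply/matrixP => -[].
  by rewrite det1 sqrtr1 invr1 mul1e.
have [a0 pM'] := schur_complement_posdef pM.
set M' := schur_complement M in pM'.
have dM : \det M = M 0 0 * \det M' by exact: (det_schur_complement (lt0r_neq0 a0)).
have [dM'0 _] := IH M' h pM' mh h0.
split; first by rewrite dM mulr_gt0.
have m1 N : measurable_fun [set: n.+1.-tuple RT] (fun t => h (qform N (vec t))).
  by apply: measurableT_comp => //; exact: measurable_qform.
have mG N : measurable_fun setT (fun p : RT * n.-tuple RT => h (p.1 ^+ 2 + qform N (vec p.2))).
  apply: measurableT_comp => //; apply: measurable_funD.
    by apply: measurable_funX; exact: measurable_fst.
  by apply: (measurableT_comp (measurable_qform N)); exact: measurable_snd.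
rewrite (@integral_product_powerS _ _ _ _ _ _ (m1 1%:M))//.
rewrite (@integral_product_powerS' _ _ _ _ _ _ (m1 M))//.
transitivity (\int[vol n]_t (((Num.sqrt (M 0 0))^-1)%R%:E *
   \int[mu]_x h (x ^+ 2 + qform M' (vec t))%R))%E.
  apply: eq_integral => t _.
  pose b := (M 0 0)^-1 * (ursubmx (M : 'M[R]_(1 + n)) *m vec t) 0 0.
  rewrite -(@ge0_integral_affine _ (Num.sqrt (M 0 0)) b (fun x => h (x ^+ 2 + qform M' (vec t))))//.
  - apply: eq_integral => x _.
    rewrite vec_tuple_cons complete_square ?gt_eqF//; last by case: pM.
    by rewrite exprMn sqr_sqrtr ?ltW.
  - by rewrite sqrtr_gt0.
  - by apply: measurableT_comp => //; exact: measurable_funD.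
have mF := measurable_fun_fubini_tonelli_G (m1 := mu) _ (mG M') (fun p => h0 _).
rewrite ge0_integralZl//=; last by move=> t _; exact: integral_ge0.
(* Exchange the integrals, so that the first coordinate becomes a parameter. *)
rewrite dM sqrtrM ?(ltW a0)// invfM EFinM -muleA; congr (_ * _)%E.
rewrite -(fubini_tonelli (m1 := mu) _ (mG M') (fun p => h0 _)).
have mF' := measurable_fun_fubini_tonelli_F (m2 := vol n) _ (mG 1%:M) (fun p => h0 _).
rewrite -ge0_integralZl//=; last 2 first.
  by under eq_fun do under eq_integral do rewrite qform1_cons.
  by move=> x _; exact: integral_ge0.
apply: eq_integral => x _.
under [in RHS]eq_integral do rewrite qform1_cons.
have mhx : measurable_fun setT (fun y : RT => h (x ^+ 2 + y)).
  by apply: measurableT_comp => //; exact: measurable_funD.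
by have [] := IH M' _ pM' mhx (fun y => h0 _).
Qed.

End quadratic_form.

Section ellipsoid.
Context {R : realType}.
Local Notation RT := (measurableTypeR R).
Local Notation mu := (@lebesgue_measure R).

Lemma posdef_det_gt0 n (M : 'M[R]_n) : posdef M -> 0 < \det M.
Proof. by move=> pM; have [] := integral_qform pM (measurable_cst 0%E) (fun=> lexx _). Qed.

Lemma measurable_qform_le n (M : 'M[R]_n) (r : R) :
  measurable [set t : n.-tuple RT | qform M (vec t) <= r].
Proof.
rewrite -[X in measurable X]setTI.
have := measurable_qform M measurableT (measurable_itv `]-oo, r]).
by congr measurable; apply/seteqP; split=> t /=; rewrite in_itv.
Qed.

Lemma measurable_qform_tail n (M : 'M[R]_n) (e : R) :
  measurable [set t : n.-tuple RT |
    (qform 1%:M (vec t) <= 1)%R /\ (e < qform M (vec t))%R].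
Proof.
rewrite (_ : [set _ | _] = [set t : n.-tuple RT | qform 1%:M (vec t) <= 1] `\`
    [set t | qform M (vec t) <= e]).
  by apply: measurableD; exact: measurable_qform_le.
apply/seteqP; split => t /= [h1 h2]; split => //.
  by apply/negP; rewrite -ltNge.
by rewrite ltNge; exact/negP.
Qed.

Lemma vol_ellipsoid n (M : 'M[R]_n) (r : R) : posdef M ->
  (vol n [set t | (qform M (vec t) <= r)%R] =
   ((Num.sqrt (\det M))^-1)%:E * vol n [set t | (qform 1%:M (vec t) <= r)%R])%E.
Proof.
move=> pM; pose h : RT -> \bar R := fun y => (\1_(`]-oo, r]%classic) y)%:E.
have mh : measurable_fun setT h.
  by apply/measurable_EFinP; exact: measurable_indic.
have hE N : (\int[vol n]_t h (qform N (vec t))%R = vol n [set t | (qform N (vec t) <= r)%R])%E.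
  transitivity (\int[vol n]_t (\1_[set t | (qform N (vec t) <= r)%R] t)%:E)%E.
    by apply: eq_integral => t _; rewrite /h !indicE; congr (_%:R%:E).
  by rewrite integral_indic//= ?setIT//; exact: measurable_qform_le.
have [|_ ] := integral_qform pM mh; last by rewrite !hE.
by move=> y; rewrite /h lee_fin.
Qed.

Lemma enorm_ge0 n (x : 'cV[R]_n) : 0 <= enorm x.
Proof. exact: sqrtr_ge0. Qed.

Lemma sqr_enorm n (x : 'cV[R]_n) : enorm x ^+ 2 = qform 1%:M x.
Proof.
by rewrite /enorm sqr_sqrtr -?qform1// qform1 sumr_ge0// => i _; exact: sqr_ge0.
Qed.

Lemma eballE n : eball 1 = [set t : n.-tuple RT | qform 1%:M (vec t) <= 1].
Proof.
apply/seteqP; split => t; rewrite /eball /= -sqr_enorm.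
  by move=> h; rewrite expr_le1// enorm_ge0.
by rewrite expr_le1// enorm_ge0.
Qed.

Lemma posdef_scalar n (a : R) : 0 < a -> posdef (a%:M : 'M[R]_n).
Proof.
move=> a0; split; first exact: tr_scalar_mx.
move=> x x0; have -> : qform a%:M x = a * qform 1%:M x.
  by rewrite /qform mulmx1 mul_mx_scalar -scalemxAl mxE.
have /cV0Pn[i xi] := x0.
by rewrite pmulr_rgt0// qform1 (sum_sqr_gt0 (f := fun i => x i 0) xi).
Qed.

Lemma vol_ball_scale n (r : R) : 0 < r ->
  exists2 c : R, 0 < c &
  (vol n [set t | (qform 1%:M (vec t) <= r)%R] = c%:E * vol n (eball 1))%E.
Proof.
move=> r0; have pM := @posdef_scalar n _ (etrans (invr_gt0 r) r0).
exists (Num.sqrt (\det (r^-1%:M : 'M[R]_n)))^-1.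
  by rewrite invr_gt0 sqrtr_gt0 posdef_det_gt0.
rewrite eballE -vol_ellipsoid//; congr (vol n _).
apply/seteqP; split => t /=; have -> : qform r^-1%:M (vec t) = r^-1 * qform 1%:M (vec t).
    by rewrite /qform mulmx1 mul_mx_scalar -scalemxAl mxE.
  by rewrite mulrC ler_pdivrMr// mul1r.
  by rewrite /qform mulmx1 mul_mx_scalar -scalemxAl mxE.
by rewrite mulrC ler_pdivrMr// mul1r.
Qed.

Lemma qform1_ge0 n (x : 'cV[R]_n) : 0 <= qform 1%:M x.
Proof. by rewrite qform1 sumr_ge0// => i _; exact: sqr_ge0. Qed.

Let sqr_le_quarter (x : R) : - 2^-1 <= x -> x <= 2^-1 -> x ^+ 2 <= 4^-1.
Proof. by move=> h1 h2; nra. Qed.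

Let le1_bounds (x y : R) : 0 <= y -> x ^+ 2 + y <= 1 -> (-1 <= x <= 1) /\ y <= 1.
Proof. by move=> y0 h; split; [apply/andP; split; nra | nra]. Qed.

(** The unit ball lies between the product of an interval with a smaller ball and
the product of an interval with the unit ball of one dimension less.  It makes
ratios of volumes meaningful after passing from extended reals to reals. *)
Lemma vol_eball_gt0_fin n : (0 < @vol R n (eball 1) < +oo)%E.
Proof.
elim: n => [|n /andP[v0 vy]].
  rewrite eballE [vol 0 _]diracE mem_set ?lte01 ?ltry//=.
  by rewrite qform1 big_ord0.
have mB k : measurable (eball 1 : set (k.-tuple RT)).
  by rewrite eballE; exact: measurable_qform_le.
have volS (A : set (n.+1.-tuple RT)) :
  vol n.+1 A = (mu \x vol n)%E (@tuple_cons _ RT n @^-1` A) by [].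
have mpre : measurable (@tuple_cons _ RT n @^-1` eball 1).
  by rewrite -[X in measurable X]setTI; apply: measurable_tuple_cons => //; exact: mB.
have [c c0 vc] := vol_ball_scale n (ltac:(lra) : 0 < 3 / 4 :> R).
rewrite volS; apply/andP; split.
- pose A : set (RT * n.-tuple RT) :=
    `[-(2^-1), 2^-1]%classic `*` [set t | qform 1%:M (vec t) <= 3 / 4].
  apply: (@lt_le_trans _ _ ((mu \x vol n)%E A)).
    rewrite product_measure1E//; last exact: measurable_qform_le.
    have l1 : mu `[-(2^-1), 2^-1]%classic = 1%E.
      by rewrite lebesgue_measure_itv /= lte_fin ifT; [rewrite -EFinD; congr (_%:E)|]; lra.
    by rewrite [X in (0 < X * _)%E]l1 mul1e vc mule_gt0// lte_fin.
  apply: le_measure; rewrite ?inE//.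
    by apply: measurableX => //; exact: measurable_qform_le.
  move=> [x t] [/=]; rewrite in_itv /= eballE /= qform1_cons => /andP[x1 x2] h.
  apply: (@le_trans _ _ (4^-1 + 3 / 4)); last by lra.
  by apply: lerD => //; exact: sqr_le_quarter.
- apply: (@le_lt_trans _ _ ((mu \x vol n)%E (`[-1, 1]%classic `*` eball 1))).
    apply: le_measure; rewrite ?inE//; first by apply: measurableX => //; exact: mB.
    move=> [x t] /=; rewrite !eballE /= qform1_cons in_itv /= => h.
    exact: le1_bounds (qform1_ge0 _) h.
  rewrite product_measure1E//; last exact: mB.
  have l2 : mu `[-1, 1]%classic = 2%:E.
    by rewrite lebesgue_measure_itv /= lte_fin ifT; [rewrite -EFinD; congr (_%:E)|]; lra.
  by rewrite [X in (X * _ < _)%E]l2 lte_mul_pinfty// lee_fin.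
Qed.

End ellipsoid.

(** * Functional calculus in an orthonormal eigenbasis *)
Section functional_calculus.
Context {F : fieldType} (n : nat) (P : 'M[F]_n).
Hypothesis P1 : P *m P^T = 1%:M.
Implicit Types f g : 'I_n -> F.

Let P1' : P^T *m P = 1%:M. Proof. exact: mulmx1C. Qed.

(** The value of f on the symmetric matrix with orthonormal eigenvectors the rows
of P, f being given on the indices of the eigenvalues. *)
Definition fcalc f : 'M[F]_n := P^T *m diag_mx (\row_j f j) *m P.

Lemma fcalc_sym f : (fcalc f)^T = fcalc f.
Proof. by rewrite /fcalc !trmx_mul trmxK tr_diag_mx mulmxA. Qed.

Lemma fcalcM f g : fcalc f *m fcalc g = fcalc (fun j => f j * g j).
Proof.
rewrite /fcalc !mulmxA -(mulmxA _ P) P1 mulmx1 -(mulmxA _ (diag_mx _) (diag_mx _)).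
rewrite mulmx_diag; congr (_ *m diag_mx _ *m _).
by apply/rowP => j; rewrite !mxE.
Qed.

Lemma fcalc_cst a : fcalc (fun=> a) = a%:M.
Proof.
rewrite /fcalc (_ : \row_j a = const_mx a); last by apply/rowP => j; rewrite !mxE.
by rewrite diag_const_mx mul_mx_scalar -scalemxAl P1' scalemx1.
Qed.

Lemma fcalcD f g : fcalc f + fcalc g = fcalc (fun j => f j + g j).
Proof.
rewrite /fcalc -mulmxDl -mulmxDr -raddfD /=; congr (_ *m diag_mx _ *m _).
by apply/rowP => j; rewrite !mxE.
Qed.

Lemma fcalcZ a f : a *: fcalc f = fcalc (fun j => a * f j).
Proof.
rewrite /fcalc scalemxAl scalemxAr -linearZ /=; congr (_ *m diag_mx _ *m _).
by apply/rowP => j; rewrite !mxE.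
Qed.

Lemma eq_fcalc f g : f =1 g -> fcalc f = fcalc g.
Proof. by move=> fg; congr (_ *m diag_mx _ *m _); apply/rowP => j; rewrite !mxE. Qed.

Lemma tr_fcalc f : \tr (fcalc f) = \sum_j f j.
Proof.
rewrite /fcalc mxtrace_mulC mulmxA P1 mul1mx mxtrace_diag.
by apply: eq_bigr => j _; rewrite mxE.
Qed.

Lemma det_fcalc f : \det (fcalc f) = \prod_j f j.
Proof.
rewrite /fcalc !det_mulmx mulrC mulrA -det_mulmx P1 det1 mul1r det_diag.
by apply: eq_bigr => j _; rewrite mxE.
Qed.

Lemma fcalc_inv f : (forall j, f j != 0) ->
  invmx (fcalc f) = fcalc (fun j => (f j)^-1).
Proof.
move=> f0; have ff : fcalc f *m fcalc (fun j => (f j)^-1) = 1%:M.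
  by rewrite fcalcM -fcalc_cst; apply: eq_fcalc => j; rewrite divff.
have [u _] := mulmx1_unit ff.
by rewrite -[LHS]mulmx1 -ff mulKmx.
Qed.

End functional_calculus.

Lemma map_fcalc (F K : fieldType) (h : {rmorphism F -> K}) n (P : 'M[F]_n) f :
  map_mx h (fcalc P f) = fcalc (map_mx h P) (h \o f).
Proof.
rewrite /fcalc !map_mxM map_trmx map_diag_mx; congr (_ *m diag_mx _ *m _).
by apply/rowP => j; rewrite !mxE.
Qed.

Section functional_calculus_qform.
Context {R : realType} (n : nat) (P : 'M[R]_n).
Hypothesis P1 : P *m P^T = 1%:M.
Implicit Types f g : 'I_n -> R.

Let P1' : P^T *m P = 1%:M. Proof. exact: mulmx1C. Qed.

Lemma qform_fcalc f x : qform (fcalc P f) x = \sum_j f j * (P *m x) j 0 ^+ 2.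
Proof.
rewrite /qform /fcalc !mulmxA -trmx_mul -mulmxA; move: (P *m x) => y.
rewrite mul_mx_diag mxE; apply: eq_bigr => j _.
by rewrite !mxE expr2 mulrCA mulrA.
Qed.

Lemma qform1_fcalc x : qform 1%:M x = \sum_j (P *m x) j 0 ^+ 2.
Proof.
by rewrite -(fcalc_cst P1) qform_fcalc; apply: eq_bigr => j _; rewrite mul1r.
Qed.

Lemma posdef_fcalc f : (forall j, 0 < f j) -> posdef (fcalc P f).
Proof.
move=> f0; split; first exact: fcalc_sym.
move=> x x0; rewrite qform_fcalc lt_def sumr_ge0 => [|i _]; last first.
  by rewrite mulr_ge0 ?sqr_ge0// ltW.
rewrite andbT; apply: contra x0; rewrite psumr_eq0 => [/allP h|i _]; last first.
  by rewrite mulr_ge0 ?sqr_ge0// ltW.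
rewrite -[x]mul1mx -P1' -mulmxA; apply/eqP.
rewrite (_ : P *m x = 0) ?mulmx0//; apply/colP => i.
have := h i (mem_index_enum _).
by rewrite mulf_eq0 (gt_eqF (f0 i)) /= sqrf_eq0 [RHS]mxE => /eqP.
Qed.

End functional_calculus_qform.

(** * The volume where a trace-free quadratic form is large *)
Section concentration.
Context {R : realType}.
Local Notation RT := (measurableTypeR R).

(** A second order lower bound for 1 - u: as the first order terms cancel for a
trace-free form, the quadratic term is what determines the exponent below. *)
Lemma expR_opp_le (u : R) : u <= 2^-1 -> expR (- (u + 2 * u ^+ 2)) <= 1 - u.
Proof.
move=> u2; have e0 := expR_ge1Dx (u + 2 * u ^+ 2).
have p : 0 < 1 + (u + 2 * u ^+ 2) by nra.
rewrite expRN; apply: (@le_trans _ _ (1 + (u + 2 * u ^+ 2))^-1).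
  by rewrite lef_pV2// posrE expR_gt0.
rewrite -div1r ler_pdivrMr//.
have : 0 <= u ^+ 2 * (1 - 2 * u) by rewrite mulr_ge0 ?sqr_ge0//; lra.
by nra.
Qed.

(** Let N be the trace-free matrix with eigenvalues b_j.  On the set in question
x^T (1 - t N) x <= 1 - t e, that is x^T M x <= 1 where M has the eigenvalues
m_j = (1 - t b_j) / (1 - t e).  The relative volume of this ellipsoid is
(prod_j m_j)^(-1/2); since the b_j sum to 0,
log (prod_j m_j) >= n t e - 2 n t^2 L^2. *)
Lemma vol_quadratic_tail n (P : 'M[R]_n) (b : 'I_n -> R) (L e : R) :
  P *m P^T = 1%:M -> 0 < e -> e <= L ->
  (forall j, `|b j| <= L) -> \sum_j b j = 0 ->
  (vol n [set t | (qform 1%:M (vec t) <= 1)%R /\ (e < qform (fcalc P b) (vec t))%R] <=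
   (expR (- (n%:R * e ^+ 2) / (16 * L ^+ 2)))%:E * vol n (eball 1))%E.
Proof.
move=> P1 e0 eL bL sb; have L0 : 0 < L by exact: lt_le_trans eL.
(* This t maximizes t e - 2 t^2 L^2. *)
pose t := e / (4 * L ^+ 2).
have t0 : 0 < t by rewrite divr_gt0// mulr_gt0// exprn_gt0.
have tL : t * L <= 4^-1.
  rewrite /t (_ : _ * L = 4^-1 * (e / L)); last by field; exact: lt0r_neq0.
  by rewrite ler_piMr// ler_pdivrMr// mul1r.
have te : t * e <= 4^-1 by rewrite (le_trans _ tL)// ler_wpM2l// ltW.
have te0 : 0 < 1 - t * e by lra.
have tb j : t * b j <= 4^-1.
  by apply: le_trans tL; rewrite ler_wpM2l ?(ltW t0)//; exact: le_trans (ler_norm _) (bL j).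
pose m j := (1 - t * b j) / (1 - t * e).
have m0 j : 0 < m j by rewrite divr_gt0//; have := tb j; lra.
have pm := posdef_fcalc P1 m0.
have mE x : qform (fcalc P m) x =
    (qform 1%:M x - t * qform (fcalc P b) x) / (1 - t * e).
  rewrite !qform_fcalc (qform1_fcalc P1) mulr_sumr -sumrB mulr_suml.
  by apply: eq_bigr => j _; rewrite /m; ring.
have sub : [set x : n.-tuple RT | qform 1%:M (vec x) <= 1 /\ e < qform (fcalc P b) (vec x)]
    `<=` [set x | qform (fcalc P m) (vec x) <= 1].
  move=> x /= [x1 xe]; rewrite mE ler_pdivrMr// mul1r.
  by rewrite lerB// ler_wpM2l// ltW.
have mset := measurable_qform_tail (fcalc P b) e.
apply: (@le_trans _ _ (vol n [set x | (qform (fcalc P m) (vec x) <= 1)%R])).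
  by apply: le_measure; rewrite ?inE//; exact: measurable_qform_le.
rewrite vol_ellipsoid// -eballE; apply: lee_pmul; rewrite ?lee_fin ?invr_ge0 ?sqrtr_ge0//.
rewrite (det_fcalc P1).
have key : expR (2 * (n%:R * e ^+ 2 / (16 * L ^+ 2))) <= \prod_j m j.
  have sb2 : \sum_j (t * b j) ^+ 2 <= n%:R * (t * L) ^+ 2.
    rewrite -[leRHS](_ : \sum_(j < n) (t * L) ^+ 2 = _); last first.
      by rewrite sumr_const card_ord mulr_natl.
    apply: ler_sum => j _.
    rewrite (exprMn 2 t (b j)) (exprMn 2 t L) (ler_wpM2l (sqr_ge0 t))//.
    rewrite -(real_normK (num_real (b j))).
    by rewrite ler_sqr ?nnegrE// ltW.
  apply: (@le_trans _ _ (\prod_(j < n) expR (t * e - (t * b j + 2 * (t * b j) ^+ 2)))).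
    rewrite -expR_sum ler_expR sumrB sumr_const card_ord big_split /= -!mulr_sumr.
    rewrite sb mulr0 add0r -[(t * e) *+ n]mulr_natl.
    have -> : 2 * (n%:R * e ^+ 2 / (16 * L ^+ 2)) = n%:R * (t * e) - 2 * (n%:R * (t * L) ^+ 2).
      by rewrite /t; field; exact: lt0r_neq0.
    by rewrite lerB// ler_wpM2l.
  apply: ler_prod => j _; rewrite expR_ge0 /= /m ler_pdivlMr//.
  apply: (@le_trans _ _ (expR (t * e - (t * b j + 2 * (t * b j) ^+ 2)) * expR (- (t * e)))).
    by rewrite ler_wpM2l ?expR_ge0// expR_ge1Dx.
  rewrite -expRD addrAC subrr add0r; apply: expR_opp_le.
  by have := tb j; lra.
rewrite mulNr expRN lef_pV2 ?posrE ?sqrtr_gt0 ?expR_gt0//; last by apply: prodr_gt0.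
rewrite -[leLHS]ger0_norm ?expR_ge0// -sqrtr_sqr ler_wsqrtr// -expRM_natl; exact: key.
Qed.

End concentration.

(** * Second moments of Gaussian vectors *)
Section normal_moments.
Context {R : realType}.
Local Notation RT := (measurableTypeR R).
Local Notation mu := (@lebesgue_measure R).
Local Notation p := (@normal_pdf R 0 1).

Let mp : measurable_fun (setT : set RT) (fun x : RT => p x).
Proof. exact: measurable_normal_pdf. Qed.

Let p0 x : 0 <= p x. Proof. exact: normal_pdf_ge0. Qed.

Lemma ge0_integral_normal_prob (f : RT -> \bar R) :
  measurable_fun setT f -> (forall x, 0 <= f x)%E ->
  (\int[@normal_prob R 0 1]_x f x = \int[mu]_x (f x * (p x)%:E))%E.
Proof.
move=> mf f0.
have dom := @normal_prob_dominates R 0 1.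
rewrite -(Radon_Nikodym_SigmaFinite.change_of_variables dom f0 measurableT mf).
apply: ae_eq_integral => //.
- apply: emeasurable_funM => //.
  exact: measurable_int (Radon_Nikodym_SigmaFinite.f_integrable dom).
- by apply: emeasurable_funM => //; exact/measurable_EFinP.
- apply: ae_eqe_mul2l.
  apply: integral_ae_eq => //.
  + exact: Radon_Nikodym_SigmaFinite.f_integrable.
  + exact/measurable_EFinP.
  + move=> A _ mA.
    by rewrite -(Radon_Nikodym_SigmaFinite.f_integral dom mA).
Qed.

Lemma normal_pdf01E x : p x = normal_peak 1 * expR (- (x ^+ 2 / 2)).
Proof.
rewrite normal_pdfE ?oner_eq0// /normal_fun subr0 expr1n.
by rewrite mulNr.
Qed.

Lemma normal_pdf01N x : p (- x) = p x.
Proof. by rewrite !normal_pdf01E sqrrN. Qed.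

Lemma integral_reflect (g : RT -> \bar R) : measurable_fun setT g ->
  (forall x, 0 <= g x)%E -> (\int[mu]_x g (- x)%R = \int[mu]_x g x)%E.
Proof.
move=> mg g0.
have mN : measurable_fun (setT : set RT) (fun x : RT => - x : RT) by exact: measurable_funN.
have h := ge0_integral_pushforward mN mu measurableT mg (fun t _ => g0 t).
rewrite -[LHS]h; apply: eq_measure_integral => A mA _.
exact: lebesgue_measureN.
Qed.

Local Ltac side := solve [
    exact/measurable_EFinP
  | apply/measurable_EFinP; exact: measurable_funM
  | by rewrite lee_fin
  | move=> x _; rewrite -?EFinM lee_fin;
    repeat first [done | exact: sqr_ge0 | apply: mulr_ge0] ].

Let I2 : \bar R := (\int[mu]_x (x ^+ 2 * p x)%:E)%E.

Let mI2 : measurable_fun (setT : set RT) (fun x : RT => x ^+ 2 * p x).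
Proof. by apply: measurable_funM => //; exact: exprn_measurable. Qed.

Let I2_ge0 : (0 <= I2)%E.
Proof. by apply: integral_ge0 => x _; rewrite lee_fin mulr_ge0// sqr_ge0. Qed.

Let int_p : (\int[mu]_x (p x)%:E = 1)%E. Proof. exact: integral_normal_pdf. Qed.

Let mps s : measurable_fun (setT : set RT) (fun x : RT => p (s * x)).
Proof. by apply: (measurableT_comp mp); exact: measurable_funM. Qed.

Let int_ps s : 0 < s -> (\int[mu]_x (p (s * x))%:E = (s^-1)%:E)%E.
Proof.
move=> s0; have := @ge0_integral_affine R s 0 (fun x => (p x)%:E) s0.
rewrite int_p mule1 => <- //.
- by apply: eq_integral => x _; rewrite addr0.
- exact/measurable_EFinP.
Qed.

Let weighted_le (N E F v : R) : 0 <= E -> 0 <= N -> 1 + - v <= F ->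
  N * E <= N * (F * E) + v * (N * E).
Proof.
move=> E0 N0 h; have : 0 <= N * E * (F - (1 + - v)) by rewrite !mulr_ge0// subr_ge0.
by lra.
Qed.

Let weighted_le' (N E F v : R) : 0 <= E -> 0 <= N -> 1 + v <= F ->
  N * E + v * (N * E) <= N * (F * E).
Proof.
move=> E0 N0 h; have : 0 <= N * E * (F - (1 + v)) by rewrite !mulr_ge0// subr_ge0.
by lra.
Qed.

(** The integral of p (s x) is 1 / s, while p (s x) = p x exp (- (s^2 - 1) x^2 / 2);
so exp u >= 1 + u bounds the second moment from one side when s > 1, and from
the other one when s < 1. *)
Let lower s : 1 < s -> (1 <= (s^-1)%:E + ((s ^+ 2 - 1) / 2)%:E * I2)%E.
Proof.
move=> s1; have s0 : 0 < s by lra.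
have k0 : 0 <= (s ^+ 2 - 1) / 2 by nra.
rewrite -int_ps// /I2 -ge0_integralZl//=; try side.
rewrite -ge0_integralD//=; try side.
rewrite -int_p; apply: ge0_le_integral => //=.
- by move=> x _; rewrite lee_fin.
- exact/measurable_EFinP.
- apply/measurable_EFinP; apply: measurable_funD; first exact: mps.
  exact: measurable_funM.
- move=> x _; rewrite lee_fin !normal_pdf01E exprMn.
  set v := (s ^+ 2 - 1) / 2 * x ^+ 2.
  have -> : - (s ^+ 2 * x ^+ 2 / 2) = - v + - (x ^+ 2 / 2) by rewrite /v; field.
  rewrite (expRD (- v)); have := expR_ge1Dx (- v).
  rewrite [(s ^+ 2 - 1) / 2 * _]
    (_ : _ = v * (normal_peak 1 * expR (- (x ^+ 2 / 2)))); last by rewrite /v; ring.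
  exact: weighted_le (expR_ge0 _) (normal_peak_ge0 _).
Qed.

Let upper s : 0 < s < 1 -> (1 + ((1 - s ^+ 2) / 2)%:E * I2 <= (s^-1)%:E)%E.
Proof.
move=> /andP[s0 s1].
have k0 : 0 <= (1 - s ^+ 2) / 2 by nra.
rewrite -int_ps// /I2 -ge0_integralZl//=; try side.
rewrite -int_p -ge0_integralD//=; try side.
apply: ge0_le_integral => //=.
- by move=> x _; rewrite -EFinM -EFinD lee_fin; apply: addr_ge0 => //;
    repeat first [done | exact: sqr_ge0 | apply: mulr_ge0].
- apply/measurable_EFinP; apply: measurable_funD => //.
  exact: measurable_funM.
- by apply/measurable_EFinP; exact: mps.
- move=> x _; rewrite lee_fin !normal_pdf01E exprMn.
  set v := (1 - s ^+ 2) / 2 * x ^+ 2.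
  have -> : - (s ^+ 2 * x ^+ 2 / 2) = v + - (x ^+ 2 / 2) by rewrite /v; field.
  rewrite (expRD v); have := expR_ge1Dx v.
  rewrite [(1 - s ^+ 2) / 2 * _]
    (_ : _ = v * (normal_peak 1 * expR (- (x ^+ 2 / 2)))); last by rewrite /v; ring.
  exact: weighted_le' (expR_ge0 _) (normal_peak_ge0 _).
Qed.

(** Letting s tend to 1 in both bounds squeezes the second moment. *)
Lemma normal_second_moment : (\int[mu]_x (x ^+ 2 * p x)%:E = 1)%E.
Proof.
rewrite -/I2; have I2fin : I2 \is a fin_num.
  have up2 := @upper 2^-1 (ltac:(apply/andP; split; lra)).
  rewrite ge0_fin_numE// ltey; apply/eqP => Iy; move: up2.
  by rewrite Iy gt0_muley ?lte_fin; [rewrite addey// leye_eq | lra].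
move: lower upper I2_ge0; rewrite -(fineK I2fin) lee_fin; set v := fine I2 => lo up v0.
have lo' s : 1 < s -> 2 <= s * (s + 1) * v.
  move=> s1; have s0 : 0 < s by lra.
  have := lo s s1; rewrite -EFinM -EFinD lee_fin => h.
  have h2 : (s - 1) * 2 <= (s - 1) * (s * (s + 1) * v).
    have := ler_wpM2l (ltW s0) h; rewrite mulr1 mulrDr divff ?gt_eqF//; lra.
  by move: h2; rewrite ler_pM2l// subr_gt0.
have up' s : 0 < s < 1 -> s * (1 + s) * v <= 2.
  move=> /andP[s0 s1].
  have := up s; rewrite s0 s1 => /(_ isT); rewrite -EFinM -EFinD lee_fin => h.
  have h2 : (1 - s) * (s * (1 + s) * v) <= (1 - s) * 2.
    have := ler_wpM2l (ltW s0) h; rewrite divff ?gt_eqF//; lra.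
  by move: h2; rewrite ler_pM2l// subr_gt0.
congr (_%:E); apply/eqP; rewrite eq_le; apply/andP; split; rewrite leNgt; apply/negP => v1.
  (* Take s = 1 - d with d = (v - 1) / (3 v) in the upper bound. *)
  have d0 : 0 < (v - 1) / (3 * v) by rewrite divr_gt0//; lra.
  have dv : (v - 1) / (3 * v) * v = (v - 1) / 3 by field; lra.
  have d1 : (v - 1) / (3 * v) < 1 by rewrite ltr_pdivrMr; lra.
  move: d0 d1 dv; move: (_ / (3 * v)) => d d0 d1 dv.
  have := up' (1 - d); have -> : 0 < 1 - d < 1 by apply/andP; split; lra.
  move=> /(_ isT); have : 0 <= d ^+ 2 * v by rewrite mulr_ge0// sqr_ge0.
  by lra.
pose d := (1 - v) / 4.
have d0 : 0 < d by rewrite /d; lra.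
have := lo' (1 + d); rewrite ltrDl => /(_ d0).
have : d * v <= d by rewrite ger_pMr//; lra.
have d1 : d <= 4^-1 by rewrite /d; lra.
have : (d * v) * d <= (d * v) * 4^-1 by rewrite ler_wpM2l// mulr_ge0// ltW.
by rewrite /d; lra.
Qed.

(** Averaging with the reflected integral removes the cross term, so that only
integrals of nonnegative functions occur. *)
Lemma normal_affine_sqr (b c : R) :
  (\int[@normal_prob R 0 1]_x ((b + c * x) ^+ 2)%:E = (b ^+ 2 + c ^+ 2)%:E)%E.
Proof.
have mq (e : R) : measurable_fun (setT : set RT) (fun x : RT => (b + e * x) ^+ 2).
  by apply: measurable_funX; apply: measurable_funD => //; exact: measurable_funM.
have mqp e : measurable_fun (setT : set RT) (fun x : RT => (b + e * x) ^+ 2 * p x).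
  exact: measurable_funM.
have q0 e x : 0 <= (b + e * x) ^+ 2 * p x by rewrite mulr_ge0// sqr_ge0.
rewrite ge0_integral_normal_prob; last 2 first.
- exact/measurable_EFinP.
- by move=> x; rewrite lee_fin sqr_ge0.
under eq_integral do rewrite -EFinM.
set J := (LHS).
have JN : (J = \int[mu]_x ((b + (- c) * x) ^+ 2 * p x)%:E)%E.
  rewrite /J -(integral_reflect (g := fun x => ((b + c * x) ^+ 2 * p x)%:E)); last 2 first.
  - exact/measurable_EFinP.
  - by move=> x; rewrite lee_fin.
  by apply: eq_integral => x _; rewrite normal_pdf01N mulrN mulNr.
have J2 : (J + J = (2 * (b ^+ 2 + c ^+ 2))%:E)%E.
  rewrite {2}JN /J -ge0_integralD//=; try side.
  transitivity (\int[mu]_x ((2 * b ^+ 2)%:E * (p x)%:E + (2 * c ^+ 2)%:E * (x ^+ 2 * p x)%:E))%E.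
    by apply: eq_integral => x _; rewrite -!EFinM -!EFinD; congr (_%:E); ring.
  have b0 : 0 <= 2 * b ^+ 2 by rewrite mulr_ge0 ?sqr_ge0.
  have c0 : 0 <= 2 * c ^+ 2 by rewrite mulr_ge0 ?sqr_ge0.
  rewrite ge0_integralD//=; try side.
  rewrite !ge0_integralZl//=; try side.
  by rewrite normal_second_moment int_p !mule1 -EFinD mulrDr.
move: J2; have J0 : (0 <= J)%E by apply: integral_ge0 => x _; rewrite lee_fin.
by move: J J0 {JN} => [j||]//= _ [h]; congr (_%:E); move: h; lra.
Qed.

End normal_moments.

Section gaussian_vector.
Context {R : realType}.
Local Notation RT := (measurableTypeR R).
Local Notation N01 := (@normal_prob R 0 1).

Lemma measurable_affine_sqr p n (a : 'cV[R]_p) (M : 'M[R]_(p, n)) (k : R) :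
  measurable_fun [set: n.-tuple RT]
    (fun g => qform 1%:M (a + M *m vec g) + k : RT).
Proof.
apply: measurable_funD; last exact: measurable_cst.
under eq_fun do rewrite qform1.
apply: measurable_sum => i; apply: measurable_funX.
under eq_fun do rewrite !mxE.
apply: measurable_funD; first exact: measurable_cst.
apply: measurable_sum => j; apply: measurable_funM; first exact: measurable_cst.
under eq_fun do rewrite mxE.
exact: measurable_tnth.
Qed.

Lemma normal_affine_vec p (b c : 'cV[R]_p) (k : R) : 0 <= k ->
  (\int[N01]_x (qform 1%:M (b + x *: c) + k)%:E =
   (qform 1%:M b + (qform 1%:M c + k))%:E)%E.
Proof.
move=> k0.
have msq i : measurable_fun (setT : set RT) (fun x : RT => (b i 0 + c i 0 * x) ^+ 2).
  by apply: measurable_funX; apply: measurable_funD => //; exact: measurable_funM.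
transitivity (\int[N01]_x ((\sum_i ((b i 0 + c i 0 * x) ^+ 2)%:E) + k%:E))%E.
  apply: eq_integral => x _; rewrite EFinD qform1 sumEFin; congr (_%:E + _)%E.
  by apply: eq_bigr => i _; rewrite !mxE mulrC.
rewrite ge0_integralD//=; try solve
  [ by move=> x _; apply: sume_ge0 => i _; rewrite lee_fin sqr_ge0
  | by apply: emeasurable_sum => i; exact/measurable_EFinP
  | by move=> x _; rewrite lee_fin ].
rewrite ge0_integral_sum//=; try solve
  [ by move=> i; exact/measurable_EFinP | by move=> i x _; rewrite lee_fin sqr_ge0 ].
rewrite integral_cst//= probability_setT mule1.
under eq_bigr do rewrite normal_affine_sqr.
by rewrite sumEFin big_split /= -!qform1 -EFinD addrA.
Qed.

(** The constant k absorbs the contribution of the coordinates that have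
already been integrated out. *)
Lemma gaussian_second_moment_aux p n (a : 'cV[R]_p) (M : 'M[R]_(p, n)) (k : R) :
  0 <= k ->
  (\int[@std_gaussian R n]_g (qform 1%:M (a + M *m vec g) + k)%:E =
   (qform 1%:M a + (\sum_i \sum_j M i j ^+ 2) + k)%:E)%E.
Proof.
elim: n a M k => [|n IH] a M k k0.
  rewrite integral_dirac//=; last first.
    by apply/measurable_EFinP; exact: measurable_affine_sqr.
  rewrite diracT mul1e (_ : M *m _ = 0) ?addr0; last first.
    by apply/matrixP => i j; rewrite !mxE big_ord0.
  rewrite big1 ?addr0// => i _; exact: big_ord0.
rewrite integral_product_powerS'; last 2 first.
- by apply/measurable_EFinP; exact: measurable_affine_sqr.
- by move=> t; rewrite lee_fin addr_ge0// qform1_ge0.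
pose M1 : 'M[R]_(p, 1 + n) := M.
have ME x (t : n.-tuple RT) :
    M *m vec (tuple_cons (x : RT, t)) = x *: col 0 M + rsubmx M1 *m vec t.
  transitivity (M1 *m col_mx x%:M (vec t)); first by rewrite -vec_tuple_cons.
  rewrite -{1}[M1]hsubmxK mul_row_col mul_mx_scalar; congr (_ *: _ + _).
  by apply/matrixP => i j; rewrite !mxE; congr (M _ _); apply/val_inj; rewrite ord1.
transitivity (\int[std_gaussian n]_t (qform 1%:M (a + rsubmx M1 *m vec t) +
    (qform 1%:M (col 0 M) + k))%:E)%E.
  apply: eq_integral => t _; rewrite -normal_affine_vec//.
  by apply: eq_integral => x _; rewrite ME [x *: _ + _]addrC addrA.
rewrite IH; last by rewrite addr_ge0// qform1_ge0.
congr (_%:E); rewrite addrA; congr (_ + k); rewrite -addrA; congr (_ + _).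
rewrite qform1 addrC -big_split /=; apply: eq_bigr => i _.
rewrite big_ord_recl mxE; congr (_ + _); apply: eq_bigr => j _; rewrite mxE.
by congr (M _ _ ^+ 2); exact/val_inj.
Qed.

Lemma gaussian_second_moment p n (a : 'cV[R]_p) (M : 'M[R]_(p, n)) :
  (\int[@std_gaussian R n]_g (enorm (a + M *m vec g) ^+ 2)%:E =
   (enorm a ^+ 2 + \tr (M *m M^T))%:E)%E.
Proof.
have := gaussian_second_moment_aux a M (lexx 0); rewrite addr0 => h.
under eq_integral do rewrite sqr_enorm -[qform _ _]addr0.
rewrite h sqr_enorm; congr (_ + _)%:E; apply: eq_bigr => i _.
by rewrite mxE; apply: eq_bigr => j _; rewrite mxE expr2.
Qed.

End gaussian_vector.

(** * Stability of the Stieltjes equation *)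
Section complex_aux.
Context {R : realType}.
Implicit Types z w : R[i].
Local Open Scope complex_scope.

Lemma Imc_inv z : complex.Im z^-1 = - complex.Im z / (complex.Re z ^+ 2 + complex.Im z ^+ 2).
Proof. by case: z => a b /=; rewrite mulNr. Qed.

Lemma Rec_inv z : complex.Re z^-1 = complex.Re z / (complex.Re z ^+ 2 + complex.Im z ^+ 2).
Proof. by case: z => a b. Qed.

Lemma Imc_mul z w : complex.Im (z * w) = complex.Re z * complex.Im w + complex.Im z * complex.Re w.
Proof. by case: z w => a b [c d]. Qed.

Lemma Imc_add z w : complex.Im (z + w) = complex.Im z + complex.Im w.
Proof. by case: z w => a b [c d]. Qed.

Lemma Imc_opp z : complex.Im (- z) = - complex.Im z.
Proof. by case: z. Qed.

Lemma Rec_add z w : complex.Re (z + w) = complex.Re z + complex.Re w.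
Proof. by case: z w => a b [c d]. Qed.

Lemma Rec_opp z : complex.Re (- z) = - complex.Re z.
Proof. by case: z. Qed.

Lemma Imc_sum (I : finType) (f : I -> R[i]) :
  complex.Im (\sum_i f i) = \sum_i complex.Im (f i).
Proof. by elim/big_rec2: _ => // i x y _ <-; rewrite Imc_add. Qed.

Lemma Imc_scale (c : R) z : complex.Im (c%:C * z) = c * complex.Im z.
Proof. by rewrite Imc_mul /= mul0r addr0. Qed.

Lemma sqr_normc z : normc z ^+ 2 = complex.Re z ^+ 2 + complex.Im z ^+ 2.
Proof. by case: z => a b /=; rewrite sqr_sqrtr ?addr_ge0 ?sqr_ge0. Qed.

Lemma normc_ge0 z : 0 <= normc z.
Proof. by case: z => a b /=; rewrite sqrtr_ge0. Qed.

Lemma Re_le_normc z : `|complex.Re z| <= normc z.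
Proof.
by case: z => a b /=; rewrite -sqrtr_sqr ler_wsqrtr// lerDl sqr_ge0.
Qed.

Lemma Im_le_normc z : `|complex.Im z| <= normc z.
Proof.
by case: z => a b /=; rewrite -sqrtr_sqr ler_wsqrtr// lerDr sqr_ge0.
Qed.

Lemma normc_real (a : R) : normc a%:C = `|a|.
Proof. by rewrite /= expr0n addr0 sqrtr_sqr. Qed.

Lemma normc_sum (I : finType) (f : I -> R[i]) :
  normc (\sum_i f i) <= \sum_i normc (f i).
Proof.
elim/big_ind2: _ => [|x a y b xa yb|//]; first by rewrite normc0.
by apply: le_trans (le_normcD _ _) _; exact: lerD.
Qed.

End complex_aux.

Section stability.
Context {R : realType} (n : nat) (k : R) (a : 'I_n -> R).
Hypotheses (k0 : 0 <= k) (a0 : forall j, 0 < a j).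
Local Open Scope complex_scope.

(** With k = 1 / (phi n) and a the eigenvalues, the Stieltjes equation is
z = psi (m(z)); [psi] and [psiC] are its right-hand side on the positive half-line
and on the upper half-plane. *)
Definition psi (m : R) : R := - m^-1 + k * \sum_j a j / (1 + a j * m).

Definition psiC (w : R[i]) : R[i] :=
  - w^-1 + k%:C * \sum_j (a j)%:C / (1 + (a j)%:C * w).

(** One has m^2 psi' (m) = 1 - df2 m, so df2 m < 1 says that psi increases at m. *)
Definition df2 (m : R) : R := k * \sum_j (a j * m / (1 + a j * m)) ^+ 2.

(** The complex counterpart of df2 is at most 1 on the graph of the transform:
the imaginary part of the equation reads
Im z |w|^2 / Im w = 1 - k sum_j a_j^2 |w|^2 / |1 + a_j w|^2, and it is
positive. *)
Lemma df2C_le1 (w z : R[i]) : 0 < complex.Im w -> 0 < complex.Im z ->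
  z = psiC w ->
  k * \sum_j normc ((a j)%:C * w / (1 + (a j)%:C * w)) ^+ 2 <= 1.
Proof.
case: w => u v /= v0 zp zE.
pose W := u ^+ 2 + v ^+ 2; pose N j := (1 + a j * u) ^+ 2 + (a j * v) ^+ 2.
have W0 : 0 < W by rewrite ltr_wpDl ?sqr_ge0// exprn_gt0.
have N0 j : 0 < N j by rewrite ltr_wpDl ?sqr_ge0// exprn_gt0// mulr_gt0.
have denE j : 1 + (a j)%:C * (u +i* v) = (1 + a j * u) +i* (a j * v).
  by apply/eqP; rewrite eq_complex /=; apply/andP; split; apply/eqP; ring.
have cE j : normc ((a j)%:C * (u +i* v) / (1 + (a j)%:C * (u +i* v))) ^+ 2 = a j ^+ 2 * W / N j.
  rewrite denE !normcM normcV !exprMn exprVn !sqr_normc /= expr0n addr0.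
  by rewrite -/W -/(N j).
under eq_bigr do rewrite cE.
have : complex.Im z = v / W - k * \sum_j a j ^+ 2 * v / N j.
  have imj j : complex.Im ((a j)%:C / (1 + (a j)%:C * (u +i* v))) = - (a j ^+ 2 * v / N j).
    by rewrite denE Imc_scale Imc_inv /= -/(N j); ring.
  rewrite zE /psiC Imc_add Imc_opp Imc_inv Imc_scale Imc_sum; under eq_bigr do rewrite imj.
  by rewrite sumrN /= -/W mulNr opprK mulrN.
move=> zi; have : 0 <= W / v * complex.Im z by rewrite mulr_ge0 ?divr_ge0// ltW.
rewrite zi mulrBr (_ : W / v * (v / W) = 1); last by field; rewrite !gt_eqF.
rewrite subr_ge0 mulrCA mulr_sumr => h; rewrite (le_trans _ h)// ler_wpM2l//.
apply: ler_sum => j _; rewrite le_eqVlt; apply/orP; left; apply/eqP; field.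
by rewrite !gt_eqF.
Qed.

(** With c_j = a_j w / (1 + a_j w) and d_j = a_j m / (1 + a_j m), the difference of
the equations for w and for m is i y w m = (w - m) (1 - k sum_j c_j d_j).  By
c d <= (c^2 + d^2) / 2 and the previous bound, |k sum_j c_j d_j| <= (1 + df2 m) / 2,
which stays away from 1. *)
Lemma stability (w : R[i]) (x y m : R) : 0 < complex.Im w -> 0 < y -> 0 < m ->
  x +i* y = psiC w -> x = psi m -> df2 m < 1 ->
  normc (w - m%:C) * ((1 - df2 m) / 2) <= y * normc w * m.
Proof.
move=> w0 y0 m0 zE xE q1.
pose c j := (a j)%:C * w / (1 + (a j)%:C * w).
pose d j := a j * m / (1 + a j * m).
have cS : k * \sum_j normc (c j) ^+ 2 <= 1 by exact: df2C_le1 zE.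
have dp j : 0 <= d j by rewrite divr_ge0// ?addr_ge0// mulr_ge0// ltW.
have wN0 : w != 0 by apply: contraTneq w0 => ->; rewrite ltxx.
have mN0 : m%:C != 0 by rewrite -(rmorph0 (real_complex R)) (inj_eq (@complexI R)) gt_eqF.
have den1 j : 1 + (a j)%:C * w != 0.
  apply/eqP => /(congr1 (@complex.Im R)); rewrite Imc_add Imc_scale /= add0r => /eqP.
  by rewrite mulf_eq0 !gt_eqF.
have den2 j : 1 + (a j)%:C * m%:C != 0.
  rewrite -rmorphM -(rmorph1 (real_complex R)) -rmorphD.
  rewrite -(rmorph0 (real_complex R)) (inj_eq (@complexI R)).
  by rewrite gt_eqF// addr_gt0// mulr_gt0.
have xEC : x%:C = - m%:C^-1 + k%:C * \sum_j (a j)%:C / (1 + (a j)%:C * m%:C).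
  rewrite xE /psi rmorphD rmorphN fmorphV rmorphM rmorph_sum; congr (_ + _ * _).
  by apply: eq_bigr => j _; rewrite fmorph_div rmorphD rmorphM rmorph1.
have key : (0 +i* y) * (w * m%:C) =
    (w - m%:C) * (1 - k%:C * \sum_j c j * (d j)%:C).
  have -> : 0 +i* y = psiC w - x%:C.
    by rewrite -zE; apply/eqP; rewrite eq_complex /= subrr subr0 !eqxx.
  rewrite xEC /psiC opprD opprK addrACA -mulrBr -sumrB.
  have ST : (\sum_j ((a j)%:C / (1 + (a j)%:C * w) -
        (a j)%:C / (1 + (a j)%:C * m%:C))) * (w * m%:C) =
      - ((w - m%:C) * \sum_j c j * (d j)%:C).
    rewrite mulr_suml mulr_sumr -sumrN; apply: eq_bigr => j _.
    rewrite /d fmorph_div rmorphM rmorphD rmorph1 rmorphM /c.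
    by field; rewrite den1 den2.
  rewrite mulrDl -mulrA ST mulrBr mulr1 mulrN (mulrCA k%:C); congr (_ - _).
  by field; rewrite wN0 mN0.
have nS : normc (k%:C * \sum_j c j * (d j)%:C) <= (1 + df2 m) / 2.
  rewrite normcM normc_real ger0_norm//.
  apply: (@le_trans _ _ (k * \sum_j (normc (c j) ^+ 2 + d j ^+ 2) / 2)).
    rewrite ler_wpM2l//; apply: le_trans (normc_sum _) _; apply: ler_sum => j _.
    rewrite normcM normc_real ger0_norm//.
    have := sqr_ge0 (normc (c j) - d j); rewrite sqrrB; lra.
  rewrite -mulr_suml mulrA ler_pM2r// big_split mulrDr /=.
  by rewrite lerD.
have := congr1 (@normc R) key; rewrite !normcM normc_real gtr0_norm//.
rewrite /= expr0n add0r sqrtr_sqr gtr0_norm// mulrA => ->.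
rewrite ler_wpM2l ?normc_ge0//.
have : normc 1 <= normc (1 - k%:C * \sum_j c j * (d j)%:C) + normc (k%:C * \sum_j c j * (d j)%:C).
  by rewrite -{1}[1 : R[i]](subrK (k%:C * \sum_j c j * (d j)%:C)); exact: le_normcD.
rewrite normc1; lra.
Qed.

End stability.

(** * The Stieltjes transform at real points *)
Section kernels.
Context {R : realType} (x0 : R).
Local Notation RT := (measurableTypeR R).

(** The imaginary part, divided by y, and the real part of
1 / (t - (x0 + i y)). *)
Definition poisson_kernel (y t : R) : R := ((t - x0) ^+ 2 + y ^+ 2)^-1.
Definition conjugate_kernel (y t : R) : R := (t - x0) / ((t - x0) ^+ 2 + y ^+ 2).

Let den_gt0 y t : 0 < y -> 0 < (t - x0) ^+ 2 + y ^+ 2.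
Proof. by move=> y0; rewrite ltr_wpDl ?sqr_ge0// exprn_gt0. Qed.

Lemma continuous_shift_sqr y : continuous (fun t : R => (t - x0) ^+ 2 + y ^+ 2).
Proof.
move=> t; apply: cvgD; last exact: cvg_cst.
have c1 : (fun t : R => t - x0) @ t --> t - x0 by apply: cvgB; [exact: cvg_id|exact: cvg_cst].
by under eq_fun do rewrite expr2; rewrite expr2; exact: cvgM.
Qed.

Lemma measurable_poisson_kernel y : 0 < y ->
  measurable_fun (setT : set RT) (poisson_kernel y).
Proof.
move=> y0; apply: continuous_measurable_fun => t; rewrite /poisson_kernel.
apply: cvgV; first by rewrite gt_eqF// den_gt0.
exact: continuous_shift_sqr.
Qed.

Lemma measurable_conjugate_kernel y : 0 < y ->
  measurable_fun (setT : set RT) (conjugate_kernel y).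
Proof.
move=> y0; apply: measurable_funM; last exact: measurable_poisson_kernel.
exact: measurable_funB.
Qed.

(** The limit holds for all t: at t = x0 both sides vanish, as 0^-1 = 0. *)
Lemma cvg_conjugate_kernel (y0 : R) (t : R) : 0 < y0 ->
  conjugate_kernel (y0 * harmonic k) t @[k --> \oo] --> (t - x0)^-1.
Proof.
move=> y00; rewrite /conjugate_kernel; have [->|s0] := eqVneq (t - x0) 0.
  by under eq_fun do rewrite mul0r; rewrite invr0; exact: cvg_cst.
rewrite (_ : (t - x0)^-1 = (t - x0) / ((t - x0) ^+ 2 + 0 ^+ 2)); last by field.
apply: cvgM; first exact: cvg_cst.
apply: cvgV; first by rewrite expr0n addr0 expf_neq0.
apply: cvgD; first exact: cvg_cst.
have h0 : y0 * harmonic k @[k --> \oo] --> (0 : R).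
  rewrite -[X in _ --> X](mulr0 y0); apply: cvgM; first exact: cvg_cst.
  exact: cvg_harmonic.
by under eq_fun do rewrite expr2; rewrite expr2; exact: cvgM.
Qed.

Lemma measurable_shift_inv : measurable_fun (setT : set RT) (fun t : RT => (t - x0)^-1).
Proof.
apply: (measurable_fun_cvg (h := fun k t => conjugate_kernel (1 * harmonic k) t)).
  by move=> k; apply: measurable_conjugate_kernel; rewrite mul1r harmonic_gt0.
by move=> t _; exact: cvg_conjugate_kernel.
Qed.

Lemma sqr_conjugate_kernel_le y t : 0 < y ->
  conjugate_kernel y t ^+ 2 <= poisson_kernel y t.
Proof.
move=> y0; rewrite /conjugate_kernel /poisson_kernel exprMn exprVn.
have D0 := den_gt0 t y0; rewrite -ler_pdivlMr ?invr_gt0 ?exprn_gt0// invrK.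
by rewrite expr2 mulKf ?gt_eqF// lerDl sqr_ge0.
Qed.

Lemma conjugate_kernel_mono y y' t : 0 < y -> y <= y' ->
  conjugate_kernel y' t ^+ 2 <= conjugate_kernel y t ^+ 2.
Proof.
move=> y0 yy'; have y'0 := lt_le_trans y0 yy'.
rewrite /conjugate_kernel !exprMn ler_wpM2l ?sqr_ge0//.
rewrite ler_sqr ?nnegrE ?invr_ge0 ?(ltW (den_gt0 _ _))//.
rewrite lef_pV2 ?posrE ?den_gt0// lerD2l ler_sqr ?nnegrE// ltW//.
Qed.

Lemma conjugate_kernel_err y t : 0 < y ->
  `|(t - x0)^-1 - conjugate_kernel y t| <= y * (t - x0)^-1 ^+ 2.
Proof.
move=> y0; rewrite /conjugate_kernel; have D0 := den_gt0 t y0.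
move: D0; set s := t - x0 => D0.
have [->|s0] := eqVneq s 0; first by rewrite invr0 mul0r subrr normr0 expr0n mulr0.
have -> : s^-1 - s / (s ^+ 2 + y ^+ 2) = y * s^-1 ^+ 2 * (y * s / (s ^+ 2 + y ^+ 2)).
  by field; rewrite s0 gt_eqF.
have p0 : 0 <= y * s^-1 ^+ 2 by rewrite mulr_ge0 ?sqr_ge0// ltW.
rewrite normrM (ger0_norm p0) ler_piMr// normrM normfV (gtr0_norm D0) ler_pdivrMr// mul1r.
rewrite ler_norml; apply/andP; split.
  have := sqr_ge0 (s + y); have := sqr_ge0 s; have := sqr_ge0 y; nra.
have := sqr_ge0 (s - y); have := sqr_ge0 s; have := sqr_ge0 y; nra.
Qed.

End kernels.

(** A bound on the Poisson integrals of rho above x0 that is uniform down to the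
real axis makes 1 / (t - x0) square integrable, and identifies its integral with the
boundary value of the real part of the Stieltjes transform. *)
Section stieltjes_real_point.
Context {R : realType} (rho : probability (measurableTypeR R) R) (x0 C y0 : R).
Local Notation RT := (measurableTypeR R).
Hypothesis y00 : 0 < y0.
Hypothesis hC : forall y, 0 < y -> y <= y0 ->
  (\int[rho]_t (poisson_kernel x0 y t)%:E <= C%:E)%E.

(** Monotone convergence for the squared conjugate kernels, which increase to
(t - x0)^-2 as y decreases to 0 and are below the Poisson kernels. *)
Lemma integral_sqr_shift_inv_le : (\int[rho]_t ((t - x0)^-1 ^+ 2)%:E <= C%:E)%E.
Proof.
pose f k (t : RT) := (conjugate_kernel x0 (y0 * harmonic k) t ^+ 2)%:E.
have yk k : 0 < y0 * harmonic k by rewrite mulr_gt0// harmonic_gt0.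
have mf k : measurable_fun setT (f k).
  apply/measurable_EFinP; apply: measurable_funX.
  exact: measurable_conjugate_kernel.
have f0 k t : True -> (0 <= f k t)%E by move=> _; rewrite lee_fin sqr_ge0.
have ndf t : True -> nondecreasing_seq (f ^~ t).
  move=> _ i j ij; rewrite lee_fin conjugate_kernel_mono// ler_wpM2l ?(ltW y00)//.
  by rewrite /harmonic lef_pV2 ?posrE// ler_nat.
have fE t : limn (f ^~ t) = ((t - x0)^-1 ^+ 2)%:E.
  apply/cvg_lim => //; apply: cvg_EFin; first exact: nearW.
  rewrite expr2 (_ : fine \o _ = (fun k =>
      conjugate_kernel x0 (y0 * harmonic k) t * conjugate_kernel x0 (y0 * harmonic k) t)).
    by apply: cvgM; exact: cvg_conjugate_kernel.
  by apply/funext => k /=; rewrite expr2.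
have := cvg_monotone_convergence (mu := rho) measurableT mf f0 ndf.
under [X in _ --> X]eq_integral do rewrite fE.
apply: cvge_le; apply: nearW => k.
have kle : y0 * harmonic k <= y0 by rewrite ler_piMr ?(ltW y00)// /harmonic invf_le1// ler1n.
apply: le_trans (hC (yk k) kle); apply: ge0_le_integral => //=.
- by move=> t; exact: f0.
- by apply/measurable_EFinP; exact: (measurable_poisson_kernel x0 (yk k)).
- by move=> t _; rewrite lee_fin; exact: (sqr_conjugate_kernel_le x0 t (yk k)).
Qed.

Let msq : measurable_fun (setT : set RT) (fun t : RT => (t - x0)^-1 ^+ 2).
Proof. by apply: measurable_funX; exact: measurable_shift_inv. Qed.

Let isq : rho.-integrable setT (EFin \o (fun t : RT => (t - x0)^-1 ^+ 2)).
Proof.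
apply/integrableP; split; first exact/measurable_EFinP.
apply: (@le_lt_trans _ _ C%:E); last exact: ltry.
rewrite (eq_integral (fun t : RT => ((t - x0)^-1 ^+ 2)%:E)).
  exact: integral_sqr_shift_inv_le.
by move=> t _; rewrite /= ger0_norm ?sqr_ge0.
Qed.

Let iinv : rho.-integrable setT (EFin \o (fun t : RT => (t - x0)^-1)).
Proof.
have i1 := integrableD measurableT (finite_measure_integrable_cst rho 1 measurableT) isq.
apply: le_integrable i1 => //.
  by apply/measurable_EFinP; exact: measurable_shift_inv.
move=> t _ /=; rewrite lee_fin.
rewrite [leRHS]ger0_norm ?addr_ge0 ?sqr_ge0// -real_normK ?num_real//.
move: (`|_|) (normr_ge0 (t - x0)^-1) => r r0.
by have := sqr_ge0 (r - 1); rewrite sqrrB1; lra.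
Qed.

Let ikern y : 0 < y -> rho.-integrable setT (EFin \o conjugate_kernel x0 y).
Proof.
move=> y1; apply: (@le_integrable _ _ _ rho setT measurableT _ (EFin \o cst (y^-1))).
- by apply/measurable_EFinP; exact: measurable_conjugate_kernel.
- move=> t _ /=; rewrite lee_fin (ger0_norm (x := y^-1)) ?invr_ge0 ?(ltW y1)//.
  rewrite -ler_sqr ?nnegrE ?invr_ge0 ?(ltW y1)// real_normK ?num_real//.
  apply: le_trans (sqr_conjugate_kernel_le _ _ y1) _.
  rewrite /poisson_kernel exprVn lef_pV2 ?posrE ?exprn_gt0 ?ltr_wpDl ?sqr_ge0 ?exprn_gt0//.
  by rewrite lerDr sqr_ge0.
- exact: finite_measure_integrable_cst.
Qed.

Lemma mreal_approx y : 0 < y ->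
  `|mreal rho x0 - \int[rho]_t conjugate_kernel x0 y t| <= y * C.
Proof.
move=> y1; rewrite /mreal -RintegralB//; last exact: ikern.
apply: le_trans (le_normr_Rintegral measurableT _) _.
  exact: integrableB iinv (ikern y1).
apply: (@le_trans _ _ (\int[rho]_t (y * (t - x0)^-1 ^+ 2))).
  apply: le_Rintegral => //.
  - exact: (integrable_norm (integrableB measurableT iinv (ikern y1))).
  - exact: integrableZl isq.
  - by move=> t _; exact: conjugate_kernel_err.
rewrite RintegralZl// ler_wpM2l ?(ltW y1)//.
rewrite /Rintegral -lee_fin fineK; first exact: integral_sqr_shift_inv_le.
exact: integrable_fin_num.
Qed.

End stieltjes_real_point.

Section psi_calculus.
Context {R : realType} (n : nat) (k : R) (a : 'I_n -> R).
Hypothesis a0 : forall j, 0 < a j.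

(** The derivative of [psi]. *)
Definition dpsi (m : R) : R := m^-1 ^+ 2 - k * \sum_j (a j / (1 + a j * m)) ^+ 2.

Lemma dpsi_df2 (m : R) : 0 < m -> m ^+ 2 * dpsi m = 1 - df2 k a m.
Proof.
move=> m0; rewrite /dpsi /df2 mulrBr -exprMn divff ?gt_eqF// expr1n.
congr (_ - _); rewrite mulrCA; congr (_ * _); rewrite mulr_sumr; apply: eq_bigr => j _.
by rewrite -exprMn mulrA (mulrC m).
Qed.

Let den_neq0 j (m : R) : 0 < m -> 1 + a j * m != 0.
Proof. by move=> m0; rewrite gt_eqF// addr_gt0// mulr_gt0. Qed.

Lemma is_derive_psi (m : R) : 0 < m -> is_derive m 1 (psi k a) (dpsi m).
Proof.
move=> m0.
have mN0 : m != 0 by rewrite gt_eqF.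
have d1 : is_derive m 1 (fun x : R => x^-1) (- m ^- 2 *: 1).
  exact: (is_deriveV (f := id)).
have dj j : is_derive m 1 (fun x : R => a j / (1 + a j * x)) (- (a j / (1 + a j * m)) ^+ 2).
  have dl : is_derive m 1 (fun x : R => 1 + a j * x) (a j).
    apply: is_derive_eq.
    by rewrite ?(add0r, scaler0, addr0, mul1r); exact: mulr1.
  have dV := is_deriveV (f := fun x : R => 1 + a j * x) (den_neq0 j m0) dl.
  apply: is_derive_eq.
  change (a j * (- (1 + a j * m) ^- 2 * a j) = - (a j / (1 + a j * m)) ^+ 2).
  by field; exact: den_neq0.
have dS : is_derive m 1 (fun x : R => \sum_j a j / (1 + a j * x))
    (\sum_j - (a j / (1 + a j * m)) ^+ 2).
  have := is_derive_sum (h := fun j x => a j / (1 + a j * x)) dj.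
  by rewrite (_ : \sum_(i < n) _ = fun x => \sum_j a j / (1 + a j * x))//;
    apply/funext => x; rewrite fct_sumE.
rewrite /psi; apply: is_derive_eq.
change (- (- m ^- 2 * 1) + k * (\sum_j - (a j / (1 + a j * m)) ^+ 2) = dpsi m).
by rewrite /dpsi sumrN mulr1 opprK mulrN exprVn.
Qed.

Lemma cvg_sum_ord (F : 'I_n -> R -> R) (l : 'I_n -> R) (m : R) :
  (forall j, F j x @[x --> m] --> l j) ->
  \sum_j F j x @[x --> m] --> \sum_j l j.
Proof.
move=> Fl; elim: (index_enum _) => [|j r IH].
  by under eq_fun do rewrite big_nil; rewrite big_nil; exact: cvg_cst.
by under eq_fun do rewrite big_cons; rewrite big_cons; exact: cvgD.
Qed.

Lemma cvg_df2 (m : R) : 0 < m -> df2 k a x @[x --> m] --> df2 k a m.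
Proof.
move=> m0; rewrite /df2; apply: cvgM; first exact: cvg_cst.
apply: cvg_sum_ord => j; under eq_fun do rewrite expr2; rewrite expr2.
have c1 : (a j * x) / (1 + a j * x) @[x --> m] --> a j * m / (1 + a j * m).
  have c2 : a j * x @[x --> m] --> a j * m by apply: cvgM; [exact: cvg_cst|exact: cvg_id].
  apply: cvgM => //; apply: cvgV; first exact: den_neq0.
  by apply: cvgD => //; exact: cvg_cst.
exact: cvgM.
Qed.

End psi_calculus.

Section spectral_density_real.
Context {R : realType} (n : nat) (P : 'M[R]_n) (lam : 'I_n -> R) (phi : R)
  (rho : probability (measurableTypeR R) R).
Hypotheses (P1 : P *m P^T = 1%:M) (lam0 : forall j, 0 < lam j) (phi0 : 0 < phi).
Hypothesis hrho : spectral_density phi (fcalc P lam) rho.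
Local Notation RT := (measurableTypeR R).
Local Notation k := (phi^-1 * n%:R^-1).
Local Open Scope complex_scope.

Lemma stieltjes_equation_fcalc (z w : R[i]) :
  stieltjes_equation phi (fcalc P lam) z w -> 0 < complex.Im w /\ z = psiC k lam w.
Proof.
move=> [w0 ->]; split => //; rewrite /psiC; congr (_ + _).
have -> : k%:C = (phi^-1)%:C * (n%:R^-1)%:C by rewrite rmorphM.
rewrite -[RHS]mulrA; congr (_ * (_ * _)).
rewrite map_fcalc.
set Q := map_mx _ P; have Q1 : Q *m Q^T = 1%:M.
  by rewrite /Q map_trmx -map_mxM P1 map_mx1.
have den0 j : 1 + w * (lam j)%:C != 0.
  apply/eqP => /(congr1 (@complex.Im R)); rewrite Imc_add mulrC Imc_scale /= add0r => /eqP.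
  by rewrite mulf_eq0 !gt_eqF.
rewrite -[1%:M](fcalc_cst Q1 1) fcalcZ fcalcD fcalc_inv// fcalcM// tr_fcalc//.
by apply: eq_bigr => j _; rewrite /= mulrC (mulrC w).
Qed.

Let k0 : 0 <= k. Proof. by rewrite mulr_ge0 ?invr_ge0 ?ler0n// ltW. Qed.

Let Im_stieltjes x y : complex.Im (stieltjes rho (x +i* y)) =
  \int[rho]_t (y * poisson_kernel x y t).
Proof.
transitivity (\int[rho]_t complex.Im (((t : R)%:C - (x +i* y))^-1)) => //.
apply: eq_Rintegral => t _; by rewrite Imc_inv /= sub0r opprK sqrrN.
Qed.

Let Re_stieltjes x y : complex.Re (stieltjes rho (x +i* y)) =
  \int[rho]_t (conjugate_kernel x y t).
Proof.
transitivity (\int[rho]_t complex.Re (((t : R)%:C - (x +i* y))^-1)) => //.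
apply: eq_Rintegral => t _; by rewrite Rec_inv /= sub0r sqrrN.
Qed.

Let ipoisson x y : 0 < y -> rho.-integrable setT (EFin \o poisson_kernel x y).
Proof.
move=> y1; apply: (@le_integrable _ _ _ rho setT measurableT _ (EFin \o cst ((y ^+ 2)^-1))).
- by apply/measurable_EFinP; exact: measurable_poisson_kernel.
- have y2 : 0 < y ^+ 2 by rewrite exprn_gt0.
  move=> t _ /=; have d0 : 0 < (t - x) ^+ 2 + y ^+ 2 by rewrite ltr_wpDl ?sqr_ge0.
  rewrite lee_fin (ger0_norm (x := (y ^+ 2)^-1)) ?invr_ge0 ?(ltW y2)//.
  by rewrite /poisson_kernel ger0_norm ?invr_ge0 ?(ltW d0)// lef_pV2 ?posrE// lerDr sqr_ge0.
- exact: finite_measure_integrable_cst.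
Qed.

(** The stability estimate shows that the transform at x + i y is within C y of m
for small y, where x = psi m; its imaginary part then bounds the Poisson integrals
by C, and its real part gives the value of the integral. *)
Lemma mreal_psi (m : R) : 0 < m -> df2 k lam m < 1 ->
  mreal rho (psi k lam m) = m.
Proof.
move=> m0 q1; set x := psi k lam m; set q := df2 k lam m in q1.
pose C := 4 * m ^+ 2 / (1 - q); pose y0 := (1 - q) / (4 * m).
have q0 : 0 < 1 - q by rewrite subr_gt0.
have y00 : 0 < y0 by rewrite divr_gt0// mulr_gt0.
have C0 : 0 < C by rewrite divr_gt0// mulr_gt0// exprn_gt0.
have near_m y : 0 < y -> y <= y0 -> normc (stieltjes rho (x +i* y) - m%:C) <= y * C.
  move=> y1 yy0; case: hrho => _ /(_ (x +i* y) y1)/stieltjes_equation_fcalc[w0 wE].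
  have := stability k0 lam0 w0 y1 m0 wE erefl q1; rewrite -/q.
  set d := normc _; set W := normc _ => h.
  have Wd : W <= d + m.
    rewrite /W -[stieltjes _ _](subrK m%:C); apply: le_trans (le_normcD _ _) _.
    by rewrite normc_real gtr0_norm// subrK.
  have d0 : 0 <= d by exact: normc_ge0.
  (* By W <= d + m the unknown d occurs on both sides of the stability estimate;
     the bound y <= y0 lets its right-hand occurrence be absorbed. *)
  have ym : y * m <= (1 - q) / 4.
    by rewrite -ler_pdivlMr//; apply: le_trans yy0 _; rewrite /y0 invfM mulrA.
  rewrite /C mulrA ler_pdivlMr//.
  have : y * W * m <= (d + m) * (y * m).
    by rewrite mulrAC mulrC ler_wpM2r// mulr_ge0// ltW.
  have : d * (y * m) <= d * ((1 - q) / 4) by rewrite ler_wpM2l.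
  rewrite expr2; lra.
have hC y : 0 < y -> y <= y0 -> (\int[rho]_t (poisson_kernel x y t)%:E <= C%:E)%E.
  move=> y1 yy0; have := near_m y y1 yy0 => h.
  have := le_trans (Im_le_normc _) h; rewrite Imc_add Imc_opp subr0 Im_stieltjes.
  rewrite RintegralZl//; last exact: ipoisson.
  move=> /(le_trans (ler_norm _)); rewrite ler_pM2l// /Rintegral -lee_fin fineK//.
  exact: integrable_fin_num (ipoisson _ _).
have close y : 0 < y -> y <= y0 -> `|mreal rho x - m| <= y * (2 * C).
  move=> y1 yy0.
  have h1 := mreal_approx y00 hC y1.
  have h2 := le_trans (Re_le_normc _) (near_m y y1 yy0).
  move: h2; rewrite Rec_add Rec_opp Re_stieltjes /= => h2.
  rewrite -[_ - m](subrKA (\int[rho]_t conjugate_kernel x y t)).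
  by apply: le_trans (ler_normD _ _) _; lra.
apply/eqP; rewrite -subr_eq0 -normr_le0 leNgt; apply/negP => d0.
set d := `|_| in close d0.
pose y := Num.min y0 (d / (4 * C)).
have y1 : 0 < y by rewrite lt_min y00 divr_gt0// mulr_gt0.
have yy0 : y <= y0 by rewrite ge_min lexx.
have yd : y <= d / (4 * C) by rewrite ge_min lexx orbT.
have := close y y1 yy0; have := ler_wpM2r (ltW (mulr_gt0 (ltr0n R 2) C0)) yd.
have -> : d / (4 * C) * (2 * C) = d / 2 by field; rewrite gt_eqF.
lra.
Qed.

(** The condition df2 < 1 is open, so the transform is a left inverse of psi on a
neighbourhood of m, and psi' (m) is nonzero. *)
Lemma derive1_mreal (m : R) : 0 < m -> df2 k lam m < 1 ->
  derive1 (mreal rho) (psi k lam m) = (dpsi k lam m)^-1.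
Proof.
move=> m0 q1.
have nm : \forall x \near m, 0 < x /\ df2 k lam x < 1.
  near=> x; split; first by near: x; exact: lt_nbhsr.
  by near: x; apply: cvgr_lt q1; exact: cvg_df2.
have dN0 : dpsi k lam m != 0.
  apply: contraTneq q1 => d0; have := dpsi_df2 k lam m0.
  by rewrite d0 mulr0 => /eqP; rewrite eq_sym subr_eq0 => /eqP <-; rewrite ltxx.
have dm := is_derive_psi k lam0 m0.
have [_ <-] : is_derive (psi k lam m) 1 (mreal rho) (dpsi k lam m)^-1.
  apply: is_derive_inverse dm dN0.
    by near=> x; apply: mreal_psi; near: x; apply: filterS nm => x [].
  near=> x; apply: differentiable_continuous; apply/derivable1_diffP.
  have x0 : 0 < x by near: x; exact: lt_nbhsr.
  by have [] := is_derive_psi k lam0 x0.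
by rewrite derive1E.
Unshelve. all: by end_near. Qed.

End spectral_density_real.

(** * The effective system in the eigenbasis of Sigma *)
Section psd_matrices.
Context {R : realType} (n : nat).
Implicit Types (Sigma : 'M[R]_n) (x : 'cV[R]_n).

Lemma psd_spectral Sigma : psd Sigma -> Sigma \in unitmx ->
  exists (P : 'M[R]_n) (lam : 'I_n -> R),
    [/\ P *m P^T = 1%:M, forall j, 0 < lam j & Sigma = fcalc P lam].
Proof.
move=> [sS pS] uS; have [P [d [P1 SE]]] := real_spectral sS.
have SE' : Sigma = fcalc P (fun j => d 0 j).
  rewrite SE /fcalc; congr (_ *m diag_mx _ *m _).
  by apply/rowP => j; rewrite !mxE.
exists P, (fun j => d 0 j); split => // j.
rewrite lt_def; apply/andP; split.
  move: uS; rewrite unitmxE unitfE SE' (det_fcalc P1).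
  by apply: contra => /eqP dj0; rewrite (bigD1 j)//= dj0 mul0r.
have := pS (P^T *m delta_mx j 0); rewrite -/(qform _ _) SE' qform_fcalc mulmxA P1 mul1mx.
rewrite (bigD1 j)//= big1 => [|i ij]; first by rewrite mxE !eqxx expr1n mulr1 addr0.
by rewrite mxE (negbTE ij) expr0n mulr0.
Qed.

Lemma sqr_enorm_mulmx m (A : 'M[R]_(m, n)) x : enorm (A *m x) ^+ 2 = qform (A^T *m A) x.
Proof. by rewrite sqr_enorm /qform mulmx1 trmx_mul !mulmxA. Qed.

Lemma sqr_enormZ (c : R) x : enorm (c *: x) ^+ 2 = c ^+ 2 * enorm x ^+ 2.
Proof.
rewrite !sqr_enorm !qform1 mulr_sumr; apply: eq_bigr => i _.
by rewrite mxE exprMn.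
Qed.

End psd_matrices.

Section diagonalized.
Context {R : realType} (n : nat) (P : 'M[R]_n) (lam : 'I_n -> R).
Hypotheses (P1 : P *m P^T = 1%:M) (lam0 : forall j, 0 < lam j).
Local Notation Sigma := (fcalc P lam).
Local Notation Q := (sqrtmx Sigma).

(** The eigenvector itself attains the value; the supremum has to be shown to be
over a bounded set. *)
Lemma eigenvalue_le_opnorm j : lam j <= opnorm Sigma.
Proof.
have sq x : enorm (Sigma *m x) ^+ 2 = \sum_i lam i ^+ 2 * (P *m x) i 0 ^+ 2.
  rewrite sqr_enorm_mulmx fcalc_sym fcalcM// qform_fcalc.
  by apply: eq_bigr => i _; rewrite expr2.
apply: ub_le_sup.
  exists (Num.sqrt (\sum_i lam i ^+ 2)) => _ [x /= x1 <-].
  have S0 : 0 <= \sum_i lam i ^+ 2 by rewrite sumr_ge0// => i _; exact: sqr_ge0.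
  rewrite -ler_sqr ?nnegrE ?sqrtr_ge0 ?enorm_ge0// sq sqr_sqrtr//.
  apply: (@le_trans _ _ ((\sum_i lam i ^+ 2) * enorm x ^+ 2)); last first.
    by rewrite ler_piMr// expr_le1 ?enorm_ge0.
  rewrite sqr_enorm (qform1_fcalc P1) mulr_sumr; apply: ler_sum => i _.
  rewrite ler_wpM2r ?sqr_ge0// (bigD1 i)//= lerDl sumr_ge0// => l _; exact: sqr_ge0.
exists (P^T *m delta_mx j 0) => /=.
  rewrite -(@expr_le1 _ 2) ?enorm_ge0// sqr_enorm (qform1_fcalc P1) mulmxA P1 mul1mx.
  rewrite (bigD1 j)//= big1 => [|i ij]; first by rewrite mxE !eqxx expr1n addr0.
  by rewrite mxE (negbTE ij) expr0n.
apply: (@pexpIrn _ 2) => //; rewrite ?nnegrE ?enorm_ge0 ?(ltW (lam0 j))//.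
rewrite sq mulmxA P1 mul1mx (bigD1 j)//= big1 => [|i ij].
  by rewrite mxE !eqxx expr1n mulr1 addr0.
by rewrite mxE (negbTE ij) expr0n mulr0.
Qed.

Lemma harmonic_trace_fcalc : harmonic_trace Sigma = n%:R^-1 * \sum_j (lam j)^-1.
Proof.
rewrite /harmonic_trace fcalc_inv// ?tr_fcalc// 1?mulrC// => j.
by rewrite gt_eqF.
Qed.

Lemma sqrtmx_fcalc : psd Q /\ Q *m Q = Sigma.
Proof.
apply: (xgetPex 0 (P := [set Q : 'M[R]_n | psd Q /\ Q *m Q = Sigma])).
exists (fcalc P (fun j => Num.sqrt (lam j))) => /=; split.
  split; first exact: fcalc_sym.
  move=> x; rewrite -/(qform _ _) qform_fcalc sumr_ge0// => j _.
  by rewrite mulr_ge0 ?sqrtr_ge0 ?sqr_ge0.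
rewrite fcalcM//; apply: eq_fcalc => j.
by rewrite -expr2 sqr_sqrtr// ltW.
Qed.

Lemma resolvent_fcalc tau : 0 < tau ->
  resolvent Sigma tau = fcalc P (fun j => (lam j + tau)^-1).
Proof.
move=> t0; rewrite /resolvent -(fcalc_cst P1 tau) fcalcD fcalc_inv// => j.
by rewrite gt_eqF// addr_gt0.
Qed.

(** The square root is an arbitrary chosen one; it commutes with Sigma, hence with
the resolvent, because Sigma is its square. *)
Lemma sqrtmx_resolventC tau : 0 < tau ->
  Q *m resolvent Sigma tau = resolvent Sigma tau *m Q.
Proof.
move=> t0; have [_ QQ] := sqrtmx_fcalc.
have u : Sigma + tau%:M \in unitmx.
  rewrite -(fcalc_cst P1 tau) fcalcD unitmxE unitfE (det_fcalc P1).
  by apply/prodf_neq0 => j _; rewrite gt_eqF// addr_gt0.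
rewrite /resolvent -{1}[Q]mul1mx -(mulVmx u) -!mulmxA; congr (_ *m _).
rewrite mulmxA (_ : (_ + _) *m Q = Q *m (Sigma + tau%:M)) ?mulmxK//.
have comm (A B : 'M[R]_n) : B *m B = A -> (A + tau%:M) *m B = B *m (A + tau%:M).
  by move=> <-; rewrite mulmxDl mulmxDr mulmxA mul_mx_scalar mul_scalar_mx.
exact: comm.
Qed.

Lemma sqr_enorm_resolvent_sqrtmx tau mu0 : 0 < tau ->
  tau ^+ 2 * enorm (resolvent Sigma tau *m Q *m mu0) ^+ 2 =
  \sum_j lam j * (tau / (lam j + tau)) ^+ 2 * (P *m mu0) j 0 ^+ 2.
Proof.
move=> t0; have [[sQ _] QQ] := sqrtmx_fcalc.
rewrite sqr_enorm_mulmx trmx_mul sQ {1}resolvent_fcalc// fcalc_sym -resolvent_fcalc//.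
rewrite sqrtmx_resolventC// mulmxA -(mulmxA _ Q) sqrtmx_resolventC//.
rewrite !mulmxA -(mulmxA _ Q Q) QQ resolvent_fcalc// !fcalcM// qform_fcalc mulr_sumr.
by apply: eq_bigr => j _; rewrite exprMn; ring.
Qed.

Lemma sqr_enorm_resolvent tau mu0 : 0 < tau ->
  tau ^+ 2 * enorm (resolvent Sigma tau *m mu0) ^+ 2 =
  \sum_j (tau / (lam j + tau)) ^+ 2 * (P *m mu0) j 0 ^+ 2.
Proof.
move=> t0; rewrite sqr_enorm_mulmx resolvent_fcalc// fcalc_sym fcalcM// qform_fcalc mulr_sumr.
by apply: eq_bigr => j _; rewrite exprMn; ring.
Qed.

(** Bias and variance: with Q the square root and S the resolvent at tau, the error
is Q S Q (Q mu0 + noise) - Q mu0, and S Sigma - 1 = - tau S turns its deterministic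
part into - tau S Q mu0. *)
Lemma prediction_error tau gamma mu0 : (0 < n)%N -> 0 < tau ->
  (\int[@std_gaussian R n]_g
    (enorm (Q *m (mu_seq Sigma mu0 gamma tau (vec g) - mu0)) ^+ 2)%:E =
  (\sum_j lam j * (tau / (lam j + tau)) ^+ 2 * (P *m mu0) j 0 ^+ 2 +
   gamma ^+ 2 * (n%:R^-1 * \sum_j (lam j / (lam j + tau)) ^+ 2))%:E)%E.
Proof.
move=> n0 t0; have [[sQ _] QQ] := sqrtmx_fcalc.
have u : Sigma + tau%:M \in unitmx.
  rewrite -(fcalc_cst P1 tau) fcalcD unitmxE unitfE (det_fcalc P1).
  by apply/prodf_neq0 => j _; rewrite gt_eqF// addr_gt0.
set c := (Num.sqrt n%:R)^-1 * gamma; set S := resolvent Sigma tau.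
have SE : S *m Sigma - 1%:M = - tau *: S.
  rewrite -(mulVmx u) -/(resolvent Sigma tau) -/S mulmxDr opprD addNKr.
  by rewrite mul_mx_scalar scaleNr.
transitivity (\int[@std_gaussian R n]_g
    (enorm (- tau *: (S *m Q *m mu0) + (c *: (S *m Sigma)) *m vec g) ^+ 2)%:E)%E.
  apply: eq_integral => g _; congr ((enorm _) ^+ 2)%:E.
  have QS : Q *m S = S *m Q by exact: sqrtmx_resolventC.
  have QSQ v : Q *m (S *m Q *m v) = S *m Sigma *m v :> 'cV_n.
    by rewrite (mulmxA Q) (mulmxA Q S) QS -(mulmxA S) QQ.
  rewrite /mu_seq -/S -/c mulmxBr QSQ mulmxDr -scalemxAr -scalemxAl addrAC.
  congr (_ + _); rewrite -{2}[Q *m mu0]mul1mx -mulmxBl SE -scalemxAl.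
  by rewrite (mulmxA S).
rewrite gaussian_second_moment sqr_enormZ sqrrN sqr_enorm_resolvent_sqrtmx//.
congr (_ + _)%:E; rewrite /S resolvent_fcalc// fcalcM// fcalcZ fcalc_sym fcalcM// tr_fcalc//.
have n0' : n%:R != 0 :> R by rewrite pnatr_eq0 -lt0n.
rewrite mulrA mulr_sumr; apply: eq_bigr => j _.
rewrite -[LHS]expr2 /c !exprMn exprVn sqr_sqrtr ?ler0n// exprVn; ring.
Qed.

Lemma effective_systemE phi sigma2 (mu0 : 'cV[R]_n) eta gamma tau : (0 < n)%N ->
  effective_system phi sigma2 Sigma mu0 eta gamma tau <->
  [/\ 0 <= gamma, 0 < tau,
    phi * gamma ^+ 2 = sigma2 +
      (\sum_j lam j * (tau / (lam j + tau)) ^+ 2 * (P *m mu0) j 0 ^+ 2 +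
       gamma ^+ 2 * (n%:R^-1 * \sum_j (lam j / (lam j + tau)) ^+ 2)) &
    phi - eta / tau = n%:R^-1 * \sum_j lam j / (lam j + tau)].
Proof.
move=> n0.
have trE : 0 < tau -> \tr (resolvent Sigma tau *m Sigma) = \sum_j lam j / (lam j + tau).
  move=> t0; rewrite resolvent_fcalc// fcalcM// tr_fcalc//.
  by apply: eq_bigr => j _; rewrite mulrC.
split=> [[g0 t0 e1 e2]|[g0 t0 e1 e2]]; split=> //.
- by move: e1; rewrite prediction_error// -EFinD => -[].
- by rewrite -trE.
- by rewrite prediction_error// e1 EFinD.
- by rewrite trE.
Qed.

Lemma risk_traces tau : 0 < tau ->
  \tr (Sigma ^+ 2 *m resolvent Sigma tau ^+ 2) = \sum_j (lam j / (lam j + tau)) ^+ 2 /\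
  \tr (Sigma *m resolvent Sigma tau ^+ 2) = \sum_j lam j / (lam j + tau) ^+ 2.
Proof.
move=> t0; rewrite !expr2 -!mulmxE resolvent_fcalc// !fcalcM// !tr_fcalc//.
by split; apply: eq_bigr => j _; rewrite -?exprMn ?invfM ?expr2 ?invfM; ring.
Qed.

End diagonalized.

(** * Location of the fixed point *)
Section averages.
Context {R : realType} (n : nat).
Hypothesis n0 : (0 < n)%N.
Implicit Types f g : 'I_n -> R.

Definition avg f : R := n%:R^-1 * \sum_j f j.

Definition centered f (j : 'I_n) : R := f j - avg f.

Let nR0 : n%:R != 0 :> R. Proof. by rewrite pnatr_eq0 -lt0n. Qed.

Lemma avg_cst c : avg (fun=> c) = c.
Proof. by rewrite /avg sumr_const card_ord -[c *+ n]mulr_natl mulKf. Qed.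

Lemma avgD f g : avg (fun j => f j + g j) = avg f + avg g.
Proof. by rewrite /avg big_split mulrDr. Qed.

Lemma avgZ c f : avg (fun j => c * f j) = c * avg f.
Proof. by rewrite /avg -mulr_sumr mulrCA. Qed.

Lemma eq_avg f g : f =1 g -> avg f = avg g.
Proof. by move=> fg; congr (_ * _); exact: eq_bigr. Qed.

Lemma le_avg f g : (forall j, f j <= g j) -> avg f <= avg g.
Proof. by move=> fg; rewrite ler_wpM2l ?invr_ge0// ler_sum. Qed.

Lemma sum_centered f : \sum_j centered f j = 0.
Proof.
by rewrite sumrB sumr_const card_ord -[avg f *+ n]mulr_natl /avg mulVKf// subrr.
Qed.

Lemma norm_centered_le f L : (forall j, 0 <= f j <= L) -> forall j, `|centered f j| <= L.
Proof.
move=> fL j; have /andP[fj0 fjL] := fL j.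
have a0 : 0 <= avg f by rewrite -(avg_cst 0) le_avg// => i; have /andP[] := fL i.
have aL : avg f <= L by rewrite -(avg_cst L) le_avg// => i; have /andP[] := fL i.
by rewrite /centered ler_norml; apply/andP; split; lra.
Qed.

Lemma centered_cst c j : centered (fun=> c) j = 0.
Proof. by rewrite /centered avg_cst subrr. Qed.

Lemma centered_lipschitz f g d : (forall j, `|f j - g j| <= d) ->
  forall j, `|centered f j - centered g j| <= 2 * d.
Proof.
move=> fg j; have h i : f i - g i <= d /\ g i - f i <= d.
  by have := fg i; rewrite ler_norml => /andP[]; split; lra.
have a1 : avg f <= avg g + d.
  by rewrite -(avg_cst d) -avgD le_avg// => i; have [] := h i; lra.
have a2 : avg g <= avg f + d.
  by rewrite -(avg_cst d) -avgD le_avg// => i; have [] := h i; lra.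
have [] := h j; rewrite /centered ler_norml => h1 h2.
by apply/andP; split; lra.
Qed.

End averages.

Section fixed_point.
Context {R : realType} (n : nat) (lam : 'I_n -> R) (K phi eta : R).
Hypotheses (n0 : (0 < n)%N) (lam0 : forall j, 0 < lam j).
Hypotheses (lamK : forall j, lam j <= K) (harmK : avg (fun j => (lam j)^-1) <= K).
Hypotheses (K1 : 1 <= K) (phi0 : 0 < phi) (Kphi : K^-1 <= phi) (phiK : phi <= K).
Hypotheses (eta0 : 0 <= eta) (etaK : eta <= K).
Hypothesis Xi_cond : K^-1 <= eta \/ phi * (1 + K^-1) <= 1.

(** The first two degrees of freedom of the regularization, and their difference
(see [dof1E]). *)
Definition dof1 (tau : R) : R := avg (fun j => lam j / (lam j + tau)).
Definition dof2 (tau : R) : R := avg (fun j => (lam j / (lam j + tau)) ^+ 2).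
Definition dof_gap (tau : R) : R := avg (fun j => lam j * tau / (lam j + tau) ^+ 2).

Let K0 : 0 < K. Proof. exact: lt_le_trans ltr01 K1. Qed.

Local Ltac kfacts := have := K0; have := K1; have := phi0; have := Kphi;
  have := phiK; have := eta0; have := etaK.
Local Ltac klra := kfacts; lra.

Let den0 j tau : 0 < tau -> lam j + tau != 0.
Proof. by move=> t0; rewrite gt_eqF// addr_gt0. Qed.

Lemma dof1E tau : 0 < tau -> dof1 tau = dof2 tau + dof_gap tau.
Proof.
move=> t0; rewrite -avgD; apply: eq_avg => j; field; exact: den0.
Qed.

Lemma avg_pred tau : 0 < tau ->
  avg (fun j => lam j * (tau / (lam j + tau)) ^+ 2) = tau * dof_gap tau.
Proof.
move=> t0; rewrite -avgZ; apply: eq_avg => j; field; exact: den0.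
Qed.

Lemma avg_est tau : 0 < tau ->
  avg (fun j => (tau / (lam j + tau)) ^+ 2) = 1 - dof2 tau - 2 * dof_gap tau.
Proof.
move=> t0; apply/eqP; rewrite eq_sym 2!subr_eq -avgZ -!avgD; apply/eqP.
by rewrite -[LHS](avg_cst n0); apply: eq_avg => j; field; exact: den0.
Qed.

Lemma avg_var tau : 0 < tau ->
  avg (fun j => lam j / (lam j + tau) ^+ 2) = dof_gap tau / tau.
Proof.
move=> t0; rewrite mulrC -avgZ; apply: eq_avg => j; field.
by rewrite den0// gt_eqF.
Qed.

Let dof1_ge0 tau : 0 < tau -> 0 <= dof1 tau.
Proof.
move=> t0; rewrite -(avg_cst n0 0); apply: le_avg => j.
by rewrite divr_ge0 ?addr_ge0 ?ltW.
Qed.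

Let dof1_le tau : 0 < tau -> dof1 tau <= K / tau.
Proof.
move=> t0; rewrite -(avg_cst n0 (K / tau)); apply: le_avg => j.
apply: (@le_trans _ _ (lam j / tau)); last by rewrite ler_pM2r ?invr_gt0.
by rewrite ler_pM2l// lef_pV2 ?posrE ?addr_gt0// lerDr ltW.
Qed.

Let dof1_ge tau : 0 < tau -> 1 - tau * K <= dof1 tau.
Proof.
move=> t0; apply: (@le_trans _ _ (avg (fun j => 1 + - tau * (lam j)^-1))).
  by rewrite avgD avgZ (avg_cst n0) mulNr lerB// ler_pM2l.
apply: le_avg => j; rewrite -subr_ge0.
have -> : lam j / (lam j + tau) - (1 + - tau / lam j) = tau ^+ 2 / (lam j * (lam j + tau)).
  by field; rewrite den0// gt_eqF.
by rewrite divr_ge0 ?sqr_ge0// mulr_ge0 ?addr_ge0 ?ltW.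
Qed.

Let continuous_fixed_point (tau : R) : 0 < tau ->
  {for tau, continuous (fun x : R => phi - eta / x - dof1 x)}.
Proof.
move=> t0; rewrite /prop_for /continuous_at.
apply: cvgB; [apply: cvgB; first exact: cvg_cst|].
  apply: cvgM; first exact: cvg_cst.
  by apply: cvgV; [rewrite gt_eqF|exact: cvg_id].
apply: cvgM; first exact: cvg_cst.
apply: cvg_sum_ord => j; apply: cvgM; first exact: cvg_cst.
apply: cvgV; first exact: den0.
by apply: cvgD; [exact: cvg_cst|exact: cvg_id].
Qed.

Local Notation t1 := ((2 * K ^+ 2)^-1).
Local Notation t2 := (2 * K ^+ 2).

Let t2_gt0 : 0 < t2. Proof. by rewrite mulr_gt0// exprn_gt0. Qed.

Let KV0 : 0 < K^-1. Proof. by rewrite invr_gt0. Qed.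
Let t1E : t1 = K^-1 ^+ 2 / 2.
Proof. by field; rewrite gt_eqF. Qed.

Let phi_le : phi * (1 + K^-1) <= 1 -> phi <= 1 - K^-1 / 2.
Proof.
move=> pK; have d0 : 0 < 1 + K^-1 by rewrite addr_gt0.
rewrite -(ler_pM2r d0); apply: le_trans pK _.
have : K^-1 <= 1 by rewrite (invf_le1 K0); exact: K1.
have := KV0; move: (K^-1) => u u0 u1; nra.
Qed.

(** Intermediate values between t1 and t2.  At t1, either eta >= 1 / K and
eta / t1 is at least phi, or phi <= 1 - 1 / (2 K), which is at most dof1 t1; at t2
both eta / t2 and dof1 t2 are at most 1 / (2 K), while phi >= 1 / K. *)
Lemma fixed_point_exists : exists2 tau, 0 < tau & phi - eta / tau = dof1 tau.
Proof.
have t12 : t1 <= t2.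
  have k1 : 1 <= K ^+ 2 by rewrite expr_ge1// ltW.
  by apply: (@le_trans _ _ 1); [rewrite invf_le1//; klra | klra].
have t1p : 0 < t1 by rewrite invr_gt0.
have F1 : phi - eta / t1 - dof1 t1 <= 0.
  have [Ke|pK] := Xi_cond.
    have := dof1_ge0 t1p; rewrite invrK => d0.
    have : K^-1 * t2 <= eta * t2 by rewrite ler_pM2r.
    have -> : K^-1 * t2 = 2 * K by field; rewrite gt_eqF.
    by klra.
  have := dof1_ge t1p; have : 0 <= eta / t1 by exact: divr_ge0 eta0 (ltW t1p).
  have -> : t1 * K = K^-1 / 2 by field; rewrite gt_eqF.
  have := phi_le pK.
  by klra.
have F2 : 0 <= phi - eta / t2 - dof1 t2.
  have := dof1_le t2_gt0.
  have : eta / t2 <= K / t2 by rewrite ler_pM2r// invr_gt0.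
  have -> : K / t2 = K^-1 / 2 by field; rewrite gt_eqF.
  by klra.
have cF : {within `[t1, t2], continuous (fun x : R => phi - eta / x - dof1 x)}.
  apply: continuous_in_subspaceT => x; rewrite inE /= in_itv /= => /andP[x1 _].
  by apply: continuous_fixed_point; exact: lt_le_trans t1p x1.
have [|c] := IVT t12 cF (v := 0).
  by rewrite ge_min F1 /= le_max F2 orbT.
rewrite in_itv /= => /andP[c1 _] /eqP; rewrite subr_eq0 => /eqP cE.
by exists c => //; exact: lt_le_trans t1p c1.
Qed.

Lemma fixed_point_range tau : 0 < tau -> phi - eta / tau = dof1 tau ->
  t1 <= tau <= t2.
Proof.
move=> t0 tE; apply/andP; split.
  have [Ke|pK] := Xi_cond.
    have h : eta <= K * tau.
      by rewrite -ler_pdivrMr//; have := dof1_ge0 t0; klra.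
    rewrite t1E -(ler_pM2l K0); have -> : K * (K^-1 ^+ 2 / 2) = K^-1 / 2 by field; rewrite gt_eqF.
    by klra.
  have := dof1_ge t0; have : 0 <= eta / tau by exact: divr_ge0 eta0 (ltW t0).
  have := phi_le pK.
  move=> h1 h2 h3; rewrite t1E -(ler_pM2r K0).
  have -> : K^-1 ^+ 2 / 2 * K = K^-1 / 2 by field; rewrite gt_eqF.
  by klra.
have h : phi * tau <= 2 * K.
  have := dof1_le t0; rewrite -tE ler_pdivlMr// mulrBl divfK ?gt_eqF//; klra.
have h2 : K^-1 * tau <= 2 * K by apply: le_trans h; rewrite ler_pM2r.
by rewrite -(ler_pM2l KV0) (_ : K^-1 * t2 = 2 * K)//; field; rewrite gt_eqF.
Qed.

(** Each term is at least lam_j / (18 K^6), and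
lam_j >= 2 / K - 1 / (K^2 lam_j) turns the bound on the harmonic mean into a lower
bound on the arithmetic one. *)
Lemma dof_gap_ge tau : t1 <= tau <= t2 -> (18 * K ^+ 7)^-1 <= dof_gap tau.
Proof.
move=> /andP[h1 h2]; have t0 : 0 < tau by apply: lt_le_trans h1; rewrite invr_gt0.
apply: (@le_trans _ _ (avg (fun j => (18 * K ^+ 6)^-1 * (2 * K^-1 + - (K^-1 ^+ 2) * (lam j)^-1)))).
  rewrite avgZ avgD (avg_cst n0) avgZ.
  have -> : (18 * K ^+ 7)^-1 = (18 * K ^+ 6)^-1 * K^-1 by field; rewrite gt_eqF.
  rewrite ler_pM2l ?invr_gt0 ?mulr_gt0 ?exprn_gt0//.
  have : K^-1 ^+ 2 * avg (fun j => (lam j)^-1) <= K^-1 ^+ 2 * K by rewrite ler_wpM2l ?sqr_ge0.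
  have -> : K^-1 ^+ 2 * K = K^-1 by field; rewrite gt_eqF.
  by lra.
apply: le_avg => j.
apply: (@le_trans _ _ ((18 * K ^+ 6)^-1 * lam j)).
  rewrite ler_pM2l ?invr_gt0 ?mulr_gt0 ?exprn_gt0// -subr_ge0.
  have -> : lam j - (2 / K + - K^-1 ^+ 2 / lam j) = (lam j)^-1 * (lam j - K^-1) ^+ 2.
    by field; rewrite !gt_eqF.
  by rewrite mulr_ge0 ?sqr_ge0// invr_ge0 ltW.
have l0 := lam0 j; have lK := lamK j.
have d0 : 0 < lam j + tau by rewrite addr_gt0.
have dK : lam j + tau <= 3 * K ^+ 2 by have := K1; nra.
have -> : (18 * K ^+ 6)^-1 * lam j = lam j * (t1 * (3 * K ^+ 2)^-1 ^+ 2) by field; rewrite gt_eqF.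
rewrite -mulrA ler_pM2l// -exprVn; apply: ler_pM => //.
- by rewrite invr_ge0 ltW.
- exact: sqr_ge0.
- rewrite ler_sqr ?nnegrE ?invr_ge0 ?(ltW d0)//; last by rewrite mulr_ge0// sqr_ge0.
  by rewrite lef_pV2// posrE mulr_gt0// exprn_gt0.
Qed.

End fixed_point.

(** * Vectors on which finitely many forms are small *)
Section good_set.
Context {R : realType}.
Local Notation RT := (measurableTypeR R).

Lemma measure_bigsetU_le d (T : measurableType d) (mu : {measure set T -> \bar R})
    (I : Type) (s : seq I) (E : I -> set T) (v : \bar R) :
  (forall i, measurable (E i)) -> (forall i, mu (E i) <= v)%E -> (0 <= v)%E ->
  measurable (\big[setU/set0]_(i <- s) E i) /\
  (mu (\big[setU/set0]_(i <- s) E i) <= (size s)%:R%:E * v)%E.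
Proof.
move=> mE Ev v0; elim: s => [|i s [mS IH]].
  by rewrite !big_nil measure0 mul0e; split.
rewrite !big_cons; split; first exact: measurableU.
apply: le_trans (measureU2 _ _ _) _ => //.
rewrite /= -natr1 EFinD addeC ge0_muleDl ?lee_fin// mul1e.
exact: leeD.
Qed.

(** A union bound over the forms and their opposites. *)
Lemma good_set n (I : finType) (P : 'M[R]_n) (b : I -> 'I_n -> R) (L e : R) :
  P *m P^T = 1%:M -> 0 < e -> e <= L ->
  (forall i j, `|b i j| <= L) -> (forall i, \sum_j b i j = 0) ->
  exists U : set (n.-tuple RT), [/\ measurable U, U `<=` eball 1,
    (forall x, U x -> forall i, `|qform (fcalc P (b i)) (vec x)| <= e) &
    1 - 2 * #|I|%:R * expR (- (n%:R * e ^+ 2) / (16 * L ^+ 2)) <=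
      fine (vol n U) / fine (vol n (eball 1))].
Proof.
move=> P1 e0 eL bL bs.
pose bb (p : I * bool) : 'I_n -> R := fun j => (-1) ^+ p.2 * b p.1 j.
have bbq p x : qform (fcalc P (bb p)) x = (-1) ^+ p.2 * qform (fcalc P (b p.1)) x.
  rewrite !qform_fcalc mulr_sumr; by apply: eq_bigr => j _; rewrite /bb -mulrA.
pose E p := [set t : n.-tuple RT |
  (qform 1%:M (vec t) <= 1)%R /\ (e < qform (fcalc P (bb p)) (vec t))%R].
have mE p : measurable (E p) by exact: measurable_qform_tail.
set x16 := (X in expR X); have /andP[V0 Vy] := @vol_eball_gt0_fin R n.
have Vfin : vol n (eball 1 : set (n.-tuple RT)) \is a fin_num by rewrite ge0_fin_numE.
have vE p : (vol n (E p) <= (expR x16)%:E * vol n (eball 1))%E.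
  apply: vol_quadratic_tail => //.
    by move=> j; rewrite /bb normrM normrX normrN1 expr1n mul1r.
  by rewrite /bb -mulr_sumr bs mulr0.
have [mU vU] := measure_bigsetU_le (enum {: I * bool}) mE vE
  (mule_ge0 (expR_ge0 _ : (0 <= (expR x16)%:E)%E) (ltW V0)).
set W := \big[setU/set0]_(i <- _) E i in mU vU.
have mB : measurable (eball 1 : set (n.-tuple RT)).
  by rewrite eballE; exact: measurable_qform_le.
exists (eball 1 `\` W); split.
- exact: measurableD.
- by move=> x [].
- move=> x [xB xW] i; rewrite leNgt; apply/negP => ei.
  apply: xW; rewrite /W -bigcup_seq.
  have x1 : qform 1%:M (vec x) <= 1 by move: xB; rewrite eballE.
  have [q0|q0] := leP 0 (qform (fcalc P (b i)) (vec x)).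
    exists (i, false) => /=; first by rewrite mem_enum.
    by split => //; rewrite bbq /= mul1r -(ger0_norm q0).
  exists (i, true) => /=; first by rewrite mem_enum.
  by split => //; rewrite bbq /= expr1 mulN1r -(ltr0_norm q0).
have Vf0 : 0 < fine (vol n (eball 1 : set (n.-tuple RT))) by rewrite fine_gt0// V0.
rewrite ler_pdivlMr// mulrBl mul1r.
have mD : measurable (eball 1 `\` W : set (n.-tuple RT)) by exact: measurableD.
have fD : vol n (eball 1 `\` W) \is a fin_num.
  rewrite ge0_fin_numE//; apply: le_lt_trans Vy; by apply: le_measure; rewrite ?inE// => x [].
have VD : (vol n (eball 1) <= vol n (eball 1 `\` W) + vol n W)%E.
  apply: le_trans (measureU2 _ _ _); [|exact: mD|exact: mU].
  apply: le_measure; rewrite ?inE//.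
  - exact: measurableU.
  - by move=> x xB; have [xW|xW] := pselect (W x); [right|left].
have h := le_trans VD (leeD (lexx _) vU).
rewrite -(fineK Vfin) -(fineK fD) -!EFinM -EFinD lee_fin -cardE card_prod card_bool natrM in h.
by lra.
Qed.

End good_set.

(** * The risk gaps as trace-free quadratic forms *)
(** Here s stands for |mu0|^2; a and b are the deviations of A and B from
their averages, T is the gap between the two degrees of freedom, and g is
gamma^2 as solved from the noise equation. *)
Section gap_identities.
Context {R : fieldType} (phi eta tau D s sigma2 a b : R).
Hypotheses (tauN : tau != 0) (DN : D != 0) (phiN : phi != 0).
Let T := D - eta / tau.
Let g := (sigma2 + (a + tau * T * s)) / D.
Let m' := phi / (tau ^+ 2 * D).

Lemma pred_gapE : a + tau * T * s + g * (phi - D) -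
  ((tau^-1 ^+ 2)^-1 * (phi * s * tau^-1 - (eta * s - sigma2) * m') - sigma2) =
  phi / D * a.
Proof. by rewrite /g /m' /T; field; rewrite ?tauN ?DN ?phiN ?oner_eq0. Qed.

Lemma est_gapE : b + (1 - (phi - D) - 2 * T) * s + g * (T / tau) -
  (s * (1 - phi) + sigma2 * tau^-1 + eta / phi * (eta * s - sigma2) * m') =
  b + T / (tau * D) * a.
Proof. by rewrite /g /m' /T; field; rewrite ?tauN ?DN ?phiN ?oner_eq0. Qed.

Lemma in_gapE : eta ^+ 2 * g / tau ^+ 2 + phi * sigma2 * (1 - 2 * eta / (phi * tau)) -
  (eta ^+ 2 / phi * (phi * s * tau^-1 - (eta * s - sigma2) * m') +
   sigma2 * (phi - 2 * eta * tau^-1)) = (eta / tau) ^+ 2 / D * a.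
Proof. by rewrite /g /m' /T; field; rewrite ?tauN ?DN ?phiN ?oner_eq0. Qed.

End gap_identities.

Section risk_gap.
Context {R : realType} (n : nat) (P : 'M[R]_n) (lam : 'I_n -> R) (K phi eta sigma2 : R).
Context (rho : probability (measurableTypeR R) R).
Hypotheses (n0 : (0 < n)%N) (P1 : P *m P^T = 1%:M) (lam0 : forall j, 0 < lam j).
Hypotheses (lamK : forall j, lam j <= K) (harmK : avg (fun j => (lam j)^-1) <= K).
Hypotheses (K1 : 1 <= K) (phi0 : 0 < phi) (Kphi : K^-1 <= phi) (phiK : phi <= K).
Hypotheses (eta0 : 0 <= eta) (etaK : eta <= K).
Hypothesis Xi_cond : K^-1 <= eta \/ phi * (1 + K^-1) <= 1.
Hypothesis sigma20 : 0 <= sigma2.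
Hypothesis hrho : spectral_density phi (fcalc P lam) rho.
Variable mu0 : 'cV[R]_n.

(** The weights of the squared coordinates of mu0 in the bias terms of the
estimation and of the prediction risk. *)
Definition est_weight (tau : R) (j : 'I_n) : R := (tau / (lam j + tau)) ^+ 2.
Definition pred_weight (tau : R) (j : 'I_n) : R := lam j * est_weight tau j.

Definition fluctuation (f : 'I_n -> R) (x : 'cV[R]_n) : R :=
  qform (fcalc P (centered f)) x.

Lemma weighted_sumE f (x : 'cV[R]_n) :
  \sum_j f j * (P *m x) j 0 ^+ 2 = fluctuation f x + avg f * enorm x ^+ 2.
Proof.
rewrite /fluctuation qform_fcalc sqr_enorm (qform1_fcalc P1) mulr_sumr -big_split /=.
by apply: eq_bigr => j _; rewrite /centered; ring.
Qed.

Local Notation k := (phi^-1 * n%:R^-1).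
Local Notation D tau := (phi - dof2 lam tau).

Let den0 j (tau : R) : 0 < tau -> lam j + tau != 0.
Proof. by move=> t0; rewrite gt_eqF// addr_gt0. Qed.

Let frac tau j : 0 < tau ->
  lam j / (1 + lam j * tau^-1) = tau * (lam j / (lam j + tau)).
Proof. by move=> t0; field; rewrite den0// gt_eqF. Qed.

(** The equation for tau is the Stieltjes equation at - eta / phi for 1 / tau. *)
Lemma psi_fixed_point tau : 0 < tau -> phi - eta / tau = dof1 lam tau ->
  psi k lam tau^-1 = - eta / phi.
Proof.
move=> t0 tE; rewrite /psi invrK; under eq_bigr do rewrite frac//.
have -> : k * (\sum_i tau * (lam i / (lam i + tau))) = phi^-1 * tau * dof1 lam tau.
  by rewrite -mulr_sumr /dof1 /avg; ring.
rewrite -tE.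
by field; rewrite !gt_eqF.
Qed.

Lemma df2_fixed_point tau : 0 < tau -> df2 k lam tau^-1 = phi^-1 * dof2 lam tau.
Proof.
move=> t0; rewrite /df2 -mulrA; congr (_ * (_ * _)); apply: eq_bigr => j _.
by congr (_ ^+ 2); field; rewrite den0// gt_eqF.
Qed.

Lemma dpsi_fixed_point tau : 0 < tau -> dpsi k lam tau^-1 = tau ^+ 2 * D tau / phi.
Proof.
move=> t0; rewrite /dpsi invrK; under eq_bigr do rewrite frac// exprMn.
have -> : k * (\sum_i tau ^+ 2 * (lam i / (lam i + tau)) ^+ 2) = phi^-1 * tau ^+ 2 * dof2 lam tau.
  by rewrite -mulr_sumr /dof2 /avg; ring.
by field; rewrite gt_eqF.
Qed.

Let D_E tau : 0 < tau -> phi - eta / tau = dof1 lam tau ->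
  D tau = eta / tau + dof_gap lam tau.
Proof. by move=> t0; rewrite (dof1E lam0)// => tE; have := tE; lra. Qed.

Let tau_range := fixed_point_range n0 lam0 lamK harmK K1 phi0 Kphi phiK eta0 etaK Xi_cond.

Let gap_ge tau : 0 < tau -> phi - eta / tau = dof1 lam tau ->
  (18 * K ^+ 7)^-1 <= dof_gap lam tau.
Proof.
move=> t0 tE; have tr := tau_range t0 tE.
exact: (dof_gap_ge n0 lam0 lamK harmK K1 tr).
Qed.

Let K0 : 0 < K. Proof. exact: lt_le_trans ltr01 K1. Qed.

Let gap_gt0 tau : 0 < tau -> phi - eta / tau = dof1 lam tau -> 0 < dof_gap lam tau.
Proof.
move=> t0 tE; apply: lt_le_trans (gap_ge t0 tE).
by rewrite invr_gt0 mulr_gt0// exprn_gt0.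
Qed.

Let D_gt0 tau : 0 < tau -> phi - eta / tau = dof1 lam tau -> 0 < D tau.
Proof.
move=> t0 tE; rewrite D_E// ltr_wpDl ?gap_gt0// divr_ge0//; exact: ltW.
Qed.

(** Solvability of the system: given tau, the noise equation is linear in
gamma^2, with the positive coefficient phi - dof2 tau. *)
Lemma effectiveP :
  let p := effective phi sigma2 (fcalc P lam) mu0 eta in
  effective_system phi sigma2 (fcalc P lam) mu0 eta p.1 p.2.
Proof.
rewrite /effective /=.
set S := [set p | _]; suff : S (xget (0, 1) S) by [].
apply: xgetPex.
have [tau t0 tE] := fixed_point_exists n0 lam0 lamK harmK K1 phi0 Kphi phiK eta0 etaK Xi_cond.
have D0 := D_gt0 t0 tE.
set A := \sum_j lam j * (tau / (lam j + tau)) ^+ 2 * (P *m mu0) j 0 ^+ 2.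
have A0 : 0 <= A.
  apply: sumr_ge0 => j _; apply: mulr_ge0; last exact: sqr_ge0.
  by apply: mulr_ge0; [exact: ltW|exact: sqr_ge0].
exists (Num.sqrt ((sigma2 + A) / D tau), tau) => /=.
apply/(effective_systemE P1 lam0) => //; split => //; first exact: sqrtr_ge0.
rewrite -/A sqr_sqrtr; last by rewrite divr_ge0 ?(ltW D0)// addr_ge0.
rewrite -/(avg _) -/(dof2 lam tau).
move: (dof2 lam tau) D0 => d D0; field; rewrite gt_eqF//.
Qed.

(** The coefficients of the two forms are at most phi / D, 1, 1 / tau and
(eta / tau)^2 / D; the bound on the last one is the
largest, (2 K^3)^2 (18 K^7) = 72 K^13. *)
Lemma risk_gap : exists2 tau : R, (2 * K ^+ 2)^-1 <= tau <= 2 * K ^+ 2 &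
  forall h : risk,
    `|risk_bar phi sigma2 (fcalc P lam) mu0 h eta - risk_script phi sigma2 rho mu0 h eta|
    <= 72 * K ^+ 13 * (`|fluctuation (pred_weight tau) mu0| + `|fluctuation (est_weight tau) mu0|).
Proof.
have := effectiveP; case eqp: (effective _ _ _ _ _) => [gamma tau] /=.
move=> /(effective_systemE P1 lam0 _ _ _ _ _ _ n0)[_ t0 gE tE].
have tE' : phi - eta / tau = dof1 lam tau by [].
have tr := tau_range t0 tE'; have /andP[tr1 tr2] := tr.
exists tau => //.
have D0 := D_gt0 t0 tE'; have T0 := gap_gt0 t0 tE'; have Tge := gap_ge t0 tE'.
have DE := D_E t0 tE'.
have psiE := psi_fixed_point t0 tE'.
have df2lt : df2 k lam tau^-1 < 1.
  by rewrite df2_fixed_point// mulrC ltr_pdivrMr// mul1r -subr_gt0.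
have tV0 : 0 < tau^-1 by rewrite invr_gt0.
have mE : mreal rho (- eta / phi) = tau^-1.
  by rewrite -psiE; exact: (mreal_psi P1 lam0 phi0 hrho).
have m'E : derive1 (mreal rho) (- eta / phi) = phi / (tau ^+ 2 * D tau).
  rewrite -psiE (derive1_mreal P1 lam0 phi0 hrho)// dpsi_fixed_point//.
  by rewrite invfM invrK mulrC.
have gA := weighted_sumE (pred_weight tau) mu0.
have gB := weighted_sumE (est_weight tau) mu0.
have [tr2S tr1S] := risk_traces P1 lam0 t0.
move: gE; rewrite -/(avg _) -/(dof2 lam tau) => gE.
rewrite (avg_pred lam0 t0) in gA; rewrite (avg_est n0 lam0 t0) in gB.
set a := fluctuation _ _ in gA *; set b := fluctuation _ _ in gB *.
set s := enorm mu0 ^+ 2 in gA gB.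
rewrite -[X in sigma2 + (X + _)]/(\sum_j pred_weight tau j * _) gA in gE.
have tN : tau != 0 by rewrite gt_eqF.
have phiN : phi != 0 by rewrite gt_eqF.
have KV : tau^-1 <= 2 * K ^+ 2.
  by rewrite -[leRHS]invrK lef_pV2// posrE invr_gt0 mulr_gt0// exprn_gt0.
have tauD : D tau = dof_gap lam tau + eta / tau by rewrite DE addrC.
have barE h : risk_bar phi sigma2 (fcalc P lam) mu0 h eta =
  match h with
  | RiskPred => a + tau * dof_gap lam tau * s + gamma ^+ 2 * dof2 lam tau
  | RiskEst => b + (1 - dof2 lam tau - 2 * dof_gap lam tau) * s
     + gamma ^+ 2 * (dof_gap lam tau / tau)
  | RiskIn => (eta * gamma / tau) ^+ 2 + phi * sigma2 * (1 - 2 * eta / (phi * tau))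
  end.
  rewrite /risk_bar eqp /=; case: h => //.
  - rewrite (sqr_enorm_resolvent_sqrtmx P1 lam0)// tr2S -gA -mulrA //.
  - rewrite (sqr_enorm_resolvent P1 lam0)// tr1S -(avg_var lam0 t0) -gB -mulrA //.
have DN : D tau != 0 by rewrite gt_eqF.
have TE : dof_gap lam tau = D tau - eta / tau by rewrite tauD addrK.
have d2 : dof2 lam tau = phi - D tau by rewrite subKr.
set Dv := D tau in m'E DN D0 TE tauD d2.
have gV : gamma ^+ 2 = (sigma2 + (a + tau * (Dv - eta / tau) * s)) / Dv.
  apply: (canRL (mulfK DN)); rewrite -TE mulrBr; move: gE; lra.
have DV : (Dv)^-1 <= 18 * K ^+ 7.
  rewrite -[leRHS]invrK lef_pV2 ?posrE ?invr_gt0 ?mulr_gt0 ?exprn_gt0//.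
  by apply: le_trans Tge _; rewrite tauD lerDl divr_ge0// ltW.
have DV0 : 0 < (Dv)^-1 by rewrite invr_gt0.
have Kpow i j : (i <= j)%N -> K ^+ i <= K ^+ j by move=> ij; exact: ler_weXn2l.
have Kp i : 0 < K ^+ i by rewrite exprn_gt0.
have coef c : 0 <= c -> c <= 72 * K ^+ 13 ->
    `|c * a| <= 72 * K ^+ 13 * (`|a| + `|b|).
  move=> c0 cK; rewrite normrM (ger0_norm c0) mulrDr.
  apply: (@le_trans _ _ (72 * K ^+ 13 * `|a|)); first by rewrite ler_wpM2r.
  by rewrite lerDl mulr_ge0// mulr_ge0// ltW.
have et : eta / tau <= 2 * K ^+ 3.
  rewrite (_ : 2 * K ^+ 3 = K * (2 * K ^+ 2)); last by ring.
  by apply: ler_pM => //; exact: ltW.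
have et0 : 0 <= eta / tau by rewrite divr_ge0// ltW.
move=> h; rewrite barE /risk_script mE m'E -/s; case: h => /=.
- rewrite TE d2 gV pred_gapE//; apply: coef.
    by rewrite mulr_ge0 ?(ltW DV0) ?(ltW phi0).
  apply: (@le_trans _ _ (K * (18 * K ^+ 7))).
    by apply: ler_pM => //; exact: ltW.
  rewrite (_ : K * _ = 18 * K ^+ 8); last by ring.
  have := Kpow 8%N 13%N isT; have := Kp 8%N; lra.
- rewrite TE d2 gV est_gapE// -TE.
  apply: le_trans (ler_normD _ _) _.
  have c0 : 0 <= dof_gap lam tau / (tau * Dv).
    exact: divr_ge0 (ltW T0) (ltW (mulr_gt0 t0 D0)).
  have c1 : dof_gap lam tau / (tau * Dv) <= 2 * K ^+ 2.
    rewrite invfM mulrCA -[leRHS]mulr1; apply: ler_pM => //.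
    + exact: ltW.
    + exact: divr_ge0 (ltW T0) (ltW D0).
    + by rewrite ler_pdivrMr// mul1r tauD lerDl.
  have c2 : 2 * K ^+ 2 <= 72 * K ^+ 13.
    by have := Kpow 2%N 13%N isT; have := Kp 2%N; lra.
  rewrite [leLHS]addrC [leRHS]mulrDr; apply: lerD.
    by rewrite normrM (ger0_norm c0) ler_wpM2r// (le_trans c1).
  rewrite -[leLHS]mul1r ler_wpM2r//.
  have := Kpow 0%N 13%N isT; rewrite expr0; lra.
- rewrite (_ : (eta * gamma / tau) ^+ 2 = eta ^+ 2 * gamma ^+ 2 / tau ^+ 2); last by field.
  rewrite gV in_gapE//; apply: coef.
    by rewrite mulr_ge0 ?sqr_ge0// ltW.
  rewrite (_ : 72 * K ^+ 13 = (2 * K ^+ 3) ^+ 2 * (18 * K ^+ 7)); last by ring.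
  apply: ler_pM => //; [exact: sqr_ge0|exact: ltW|].
  by rewrite ler_sqr ?nnegrE// mulr_ge0// ltW.
Qed.

End risk_gap.

(** * Uniformity in the regularization *)
Section fluctuation_lipschitz.
Context {R : realType} (n : nat) (P : 'M[R]_n) (lam : 'I_n -> R) (K t1 : R).
Hypotheses (n0 : (0 < n)%N) (P1 : P *m P^T = 1%:M) (lam0 : forall j, 0 < lam j).
Hypotheses (lamK : forall j, lam j <= K) (K1 : 1 <= K) (t1_gt0 : 0 < t1).

Lemma est_weight_itv tau j : 0 < tau -> 0 <= est_weight lam tau j <= 1.
Proof.
move=> t0; have d0 : 0 < lam j + tau by rewrite addr_gt0.
rewrite /est_weight sqr_ge0 expr_le1//; last by rewrite divr_ge0 ?ltW.
by rewrite ler_pdivrMr// mul1r lerDr ltW.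
Qed.

Lemma pred_weight_itv tau j : 0 < tau -> 0 <= pred_weight lam tau j <= K.
Proof.
move=> t0; have /andP[e0 e1] := est_weight_itv j t0.
rewrite /pred_weight mulr_ge0 ?(ltW (lam0 j))//=.
by rewrite -[leRHS]mulr1 ler_pM// ltW.
Qed.

(** The difference of the two quotients tau / (lam + tau) is
lam (tau - tau') / ((lam + tau) (lam + tau')), and 1 / (lam + tau') <= 1 / t1. *)
Lemma est_weight_lipschitz tau tau' j : t1 <= tau -> t1 <= tau' ->
  `|est_weight lam tau j - est_weight lam tau' j| <= 2 / t1 * `|tau - tau'|.
Proof.
move=> h h'; have t0 := lt_le_trans t1_gt0 h; have t0' := lt_le_trans t1_gt0 h'.
have l0 := lam0 j.
have d0 : 0 < lam j + tau by rewrite addr_gt0.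
have d0' : 0 < lam j + tau' by rewrite addr_gt0.
have -> : est_weight lam tau j - est_weight lam tau' j =
    (tau / (lam j + tau) + tau' / (lam j + tau')) *
    ((lam j / (lam j + tau)) * (lam j + tau')^-1) * (tau - tau').
  by rewrite /est_weight; field; rewrite !gt_eqF.
have f1 (t : R) : 0 < t -> 0 < lam j + t -> 0 <= t / (lam j + t) <= 1.
  by move=> t00 dd; rewrite (divr_ge0 (ltW t00) (ltW dd)) /= ler_pdivrMr// mul1r lerDr ltW.
have /andP[a0 a1] := f1 tau t0 d0; have /andP[b0 b1] := f1 tau' t0' d0'.
have g0 : 0 <= lam j / (lam j + tau) by rewrite divr_ge0 ?ltW.
have g1 : lam j / (lam j + tau) <= 1 by rewrite ler_pdivrMr// mul1r lerDl ltW.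
have i0 : 0 <= (lam j + tau')^-1 by rewrite invr_ge0 ltW.
have i1 : (lam j + tau')^-1 <= t1^-1.
  by rewrite lef_pV2 ?posrE// (le_trans h')// lerDr ltW.
rewrite normrM; apply: ler_wpM2r => //.
rewrite ger0_norm; last exact: mulr_ge0 (addr_ge0 a0 b0) (mulr_ge0 g0 i0).
apply: ler_pM => //; first exact: addr_ge0.
- exact: mulr_ge0.
- lra.
- by rewrite -[leRHS]mul1r; apply: ler_pM.
Qed.

Lemma pred_weight_lipschitz tau tau' j : t1 <= tau -> t1 <= tau' ->
  `|pred_weight lam tau j - pred_weight lam tau' j| <= K * (2 / t1 * `|tau - tau'|).
Proof.
move=> h h'; rewrite /pred_weight -mulrBr normrM (gtr0_norm (lam0 j)).
by apply: ler_pM => //; [exact: ltW|exact: est_weight_lipschitz].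
Qed.

Lemma fluctuation_close f g d (x : 'cV[R]_n) :
  (forall j, `|f j - g j| <= d) -> enorm x <= 1 ->
  `|fluctuation P f x| <= `|fluctuation P g x| + 2 * d.
Proof.
move=> fg x1; rewrite -lerBlDl.
apply: le_trans (lerB_dist _ _) _.
rewrite /fluctuation !qform_fcalc -sumrB.
under eq_bigr do rewrite -mulrBl.
have cl := centered_lipschitz n0 fg.
have d0 : 0 <= 2 * d by apply: le_trans (cl (Ordinal n0)).
apply: (@le_trans _ _ (2 * d * enorm x ^+ 2)).
  rewrite sqr_enorm (qform1_fcalc P1) mulr_sumr.
  apply: le_trans (ler_norm_sum _ _ _) _; apply: ler_sum => j _.
  by rewrite normrM (ger0_norm (sqr_ge0 _)) ler_wpM2r// sqr_ge0.
by rewrite ler_piMr// expr_le1// enorm_ge0.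
Qed.

End fluctuation_lipschitz.

Section uniform_good_set.
Context {R : realType} (n : nat) (P : 'M[R]_n) (lam : 'I_n -> R) (K : R).
Hypotheses (n0 : (0 < n)%N) (P1 : P *m P^T = 1%:M) (lam0 : forall j, 0 < lam j).
Hypotheses (lamK : forall j, lam j <= K) (K1 : 1 <= K).
Local Notation RT := (measurableTypeR R).
Local Notation t1 := ((2 * K ^+ 2)^-1).
Local Notation t2 := (2 * K ^+ 2).

(** The bound e on a grid of step h becomes 2 e on the whole interval; with two
forms and two signs per grid point, the number of excluded sets is at most
4 (t2 / h + 1) <= 68 K^5 / e. *)
Lemma uniform_good_set (e : R) : 0 < e -> e <= 1 ->
  exists U : set (n.-tuple RT), [/\ measurable U, U `<=` eball 1,
    (forall x, U x -> forall tau, t1 <= tau <= t2 ->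
       `|fluctuation P (pred_weight lam tau) (vec x)| <= 2 * e /\
       `|fluctuation P (est_weight lam tau) (vec x)| <= 2 * e) &
    1 - (68 * K ^+ 5 / e) * expR (- (n%:R * e ^+ 2) / (16 * K ^+ 2)) <=
      fine (vol n U) / fine (vol n (eball 1))].
Proof.
move=> e0 e1; have K0 : 0 < K by exact: lt_le_trans ltr01 K1.
have Kp i : 0 < K ^+ i by rewrite exprn_gt0.
have t1p : 0 < t1 by rewrite invr_gt0 mulr_gt0.
(* The fluctuations are (2 K (2 / t1))-Lipschitz in tau, that is (8 K^3)-Lipschitz. *)
pose h := e / (8 * K ^+ 3).
have h0 : 0 < h by rewrite divr_gt0// mulr_gt0.
pose N := Num.truncn (t2 / h).
pose grid (i : 'I_N.+1) : R := t1 + h * i%:R.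
have grid0 i : 0 < grid i by rewrite ltr_wpDr// mulr_ge0// ltW.
pose b (p : 'I_N.+1 * bool) : 'I_n -> R :=
  centered (if p.2 then pred_weight lam (grid p.1) else est_weight lam (grid p.1)).
have bK p j : `|b p j| <= K.
  apply: norm_centered_le => // i; case: (p.2).
    exact: pred_weight_itv.
  have /andP[a0 a1] := est_weight_itv lam0 i (grid0 p.1).
  by rewrite a0 (le_trans a1).
have bs p : \sum_j b p j = 0 by exact: sum_centered.
have [U [mU UB Ub volU]] := good_set P1 e0 (le_trans e1 K1) bK bs.
exists U; split => //.
- move=> x Ux tau /andP[tau1 tau2].
  have x1 : enorm (vec x) <= 1 by exact: UB.
  have d0 : 0 <= (tau - t1) / h by rewrite divr_ge0 ?subr_ge0// ltW.
  have /andP[k1 k2] := truncn_itv d0; set k := Num.truncn _ in k1 k2.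
  have kN : (k < N.+1)%N.
    rewrite ltnS; apply: le_truncn; rewrite ler_pM2r ?invr_gt0//.
    by rewrite lerBlDr (le_trans tau2)// lerDl ltW.
  pose i := Ordinal kN.
  have gi : grid i <= tau.
    by rewrite /grid -lerBrDl mulrC -ler_pdivlMr.
  have gi' : `|tau - grid i| <= h.
    rewrite ger0_norm ?subr_ge0//; move: k2.
    by rewrite ltr_pdivrMr// -(natr1 k) /grid /i /=; lra.
  have t1g : t1 <= grid i by rewrite lerDl mulr_ge0// ltW.
  have lip : 2 / t1 * `|tau - grid i| <= 4 * K ^+ 2 * h.
    rewrite invrK mulrA (_ : 2 * 2 = 4); last by ring.
    by rewrite ler_pM2l// mulr_gt0.
  have lipE : K * (4 * K ^+ 2 * h) = e / 2.
    by rewrite /h; field; rewrite gt_eqF.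
  have lipE' : 4 * K ^+ 2 * h <= e / 2.
    by rewrite -lipE ler_peMl// mulr_ge0 ?(ltW h0)// mulr_ge0// ltW.
  split.
    have := Ub x Ux (i, true); rewrite -/(fluctuation _ _ _) => fi.
    have := fluctuation_close n0 P1 (fun j =>
      le_trans (pred_weight_lipschitz lam0 lamK t1p j tau1 t1g)
      (ler_wpM2l (ltW K0) lip)) x1.
    rewrite lipE => h1; apply: le_trans h1 _.
    by move: fi; rewrite /b /fluctuation /=; lra.
  have := Ub x Ux (i, false) => fi.
  have := fluctuation_close n0 P1 (fun j => le_trans (est_weight_lipschitz lam0 t1p j tau1 t1g)
    (le_trans lip lipE')) x1.
  by move: fi; rewrite /b /fluctuation /=; lra.
- apply: le_trans volU; rewrite lerD2l lerN2 ler_wpM2r ?expR_ge0//.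
  rewrite card_prod card_ord card_bool natrM -(natr1 N).
  have N1 : N%:R <= t2 / h by rewrite truncn_le divr_ge0// ltW// mulr_gt0.
  have -> : 68 * K ^+ 5 / e = 4 * (t2 / h) + 4 * (K ^+ 5 / e) by rewrite /h; field; rewrite !gt_eqF.
  have : 1 <= K ^+ 5 / e.
    by rewrite ler_pdivlMr// mul1r (le_trans e1)// exprn_ege1.
  by lra.
Qed.

End uniform_good_set.

(** * The uniform risk bound *)
Section sup_risk.
Context {R : realType}.
Local Notation RT := (measurableTypeR R).

Lemma sup_risk_gap_le n (K phi sigma2 : R) Sigma rho (U : set (n.-tuple RT)) h (e : R) :
  (forall x eta, U x -> Xi K phi eta ->
    `|risk_bar phi sigma2 Sigma (vec x) h eta - risk_script phi sigma2 rho (vec x) h eta| <= e) ->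
  (sup_risk_gap K phi sigma2 Sigma rho U h <= e%:E)%E.
Proof.
move=> he; apply: ge_ereal_sup => _ [x Ux <-].
by apply: ge_ereal_sup => _ [eta Xeta <-]; rewrite lee_fin; exact: he.
Qed.

Lemma Xi_bounds (K phi eta : R) : 0 < K -> 0 < phi -> K^-1 <= phi^-1 <= K ->
  Xi K phi eta ->
  [/\ 0 <= eta, eta <= K & K^-1 <= eta \/ phi * (1 + K^-1) <= 1].
Proof.
move=> K0 phi0 /andP[p1 p2]; rewrite /Xi /= in_itv /= => /andP[e1 e2].
move: e1; case: ifPn => [_ e1|].
  by split=> //; [apply: le_trans e1; rewrite invr_ge0 ltW | left].
rewrite -leNgt => h e1; split => //; right.
by have := ler_wpM2l (ltW phi0) h; rewrite divff ?gt_eqF.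
Qed.

Lemma fluctuation_cst n (P : 'M[R]_n) (c : R) x : (0 < n)%N ->
  fluctuation P (fun=> c) x = 0.
Proof.
move=> n0; rewrite /fluctuation qform_fcalc big1// => j _.
by rewrite centered_cst// mul0r.
Qed.

End sup_risk.

Theorem theorem3p3 (R : realType) (K : R) (hK : 0 < K) :
  exists C : R, 0 < C /\
    forall (m n : nat) (Sigma : 'M[R]_n) (sigma2 : R)
      (rho : probability (measurableTypeR R) R),
    (0 < m)%N -> (0 < n)%N ->
    let phi : R := m%:R / n%:R in
    psd Sigma -> Sigma \in unitmx ->
    K^-1 <= phi^-1 <= K ->
    0 <= sigma2 <= K ->
    Num.max (opnorm Sigma) (harmonic_trace Sigma) <= K ->
    spectral_density phi Sigma rho ->
    (forall eps : R, 0 < eps <= 2^-1 ->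
       exists U : set (n.-tuple (measurableTypeR R)),
         large_subset C eps U /\
         forall h : risk,
           (sup_risk_gap K phi sigma2 Sigma rho U h <= eps%:E)%E)
    /\
    (Sigma = 1%:M ->
       (forall eps : R, 0 < eps <= 2^-1 -> large_subset C eps (@eball R n 1)) /\
       forall h : risk,
         (sup_risk_gap K phi sigma2 Sigma rho (@eball R n 1) h <= 0)%E).
Proof.
(* The level e = eps / (288 K^13) makes 72 K^13 (2 e + 2 e) equal to eps; C is then
   read off the exponent n e^2 / (16 K^2), and it exceeds the prefactor. *)
have [C CE] : exists C : R, C = 16 * (288 * K ^+ 13) ^+ 2 * K ^+ 2 by eexists.
have C0 : 0 < C by rewrite CE !mulr_gt0 ?exprn_gt0 ?mulr_gt0 ?exprn_gt0.
exists C; split => // m n Sigma sigma2 rho m0 n0 phi pS uS phiK /andP[s0 sK].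
rewrite ge_max => /andP[opK hK'] hrho.
have phi0 : 0 < phi by rewrite divr_gt0// ltr0n.
have /andP[p1 p2] := phiK.
have K1 : 1 <= K.
  have := ler_wpM2l (ltW hK) (le_trans p1 p2).
  rewrite divff ?gt_eqF// -expr2 => K2.
  by rewrite -(@ler_sqr _ 1) ?nnegrE ?(ltW hK)// expr1n.
have Kphi : K^-1 <= phi by rewrite -[leRHS]invrK lef_pV2 ?posrE// invr_gt0.
have phiK' : phi <= K by rewrite -[leLHS]invrK -[leRHS]invrK lef_pV2 ?posrE ?invr_gt0.
have Kp i : 0 < K ^+ i by rewrite exprn_gt0.
have gap (P : 'M[R]_n) (lam : 'I_n -> R) : P *m P^T = 1%:M -> (forall j, 0 < lam j) ->
    Sigma = fcalc P lam -> forall x eta h, Xi K phi eta ->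
    exists2 tau : R, (2 * K ^+ 2)^-1 <= tau <= 2 * K ^+ 2 &
    `|risk_bar phi sigma2 Sigma x h eta - risk_script phi sigma2 rho x h eta| <=
      72 * K ^+ 13 * (`|fluctuation P (pred_weight lam tau) x| +
                      `|fluctuation P (est_weight lam tau) x|).
  move=> P1 lam0 SE x eta h Xeta.
  have [eta0 etaK Xc] := Xi_bounds hK phi0 phiK Xeta.
  have lamK j : lam j <= K.
    by apply: le_trans opK; rewrite SE; exact: eigenvalue_le_opnorm.
  have harmK : avg (fun j => (lam j)^-1) <= K.
    by move: hK'; rewrite SE (harmonic_trace_fcalc P1 lam0).
  rewrite SE in hrho *.
  have [tau tr gapE] := risk_gap n0 P1 lam0 lamK harmK K1 phi0 Kphi phiK' eta0 etaK Xc s0 hrho x.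
  by exists tau.
split.
- move=> eps /andP[eps0 eps1].
  have [P [lam [P1 lam0 SE]]] := psd_spectral pS uS.
  have lamK j : lam j <= K.
    by apply: le_trans opK; rewrite SE; exact: eigenvalue_le_opnorm.
  pose e := eps / (288 * K ^+ 13).
  have e0 : 0 < e by rewrite divr_gt0// mulr_gt0.
  have K13 : 1 <= K ^+ 13 by exact: exprn_ege1.
  have e1 : e <= 1 by rewrite ler_pdivrMr ?mulr_gt0//; lra.
  have [U [mU UB Uf volU]] := uniform_good_set n0 P1 lam0 lamK K1 e0 e1.
  exists U; split.
    split=> //; apply: le_trans volU; rewrite lerD2l lerN2.
    have eE : - (n%:R * e ^+ 2) / (16 * K ^+ 2) = - (n%:R * eps ^+ 2) / C.
      by rewrite /e CE; field; rewrite gt_eqF.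
    rewrite eE ler_wpM2r ?expR_ge0//.
    have -> : 68 * K ^+ 5 / e = 288 * (68 * K ^+ 18) * eps^-1.
      by rewrite /e; field; rewrite !gt_eqF.
    rewrite ler_pM2r ?invr_gt0//.
    have -> : C = 288 * (16 * (288 * K ^+ 28)) by rewrite CE; ring.
    rewrite ler_pM2l//; have : K ^+ 18 <= K ^+ 28 by exact: ler_weXn2l.
    by have := Kp 18%N; lra.
  move=> h; apply: sup_risk_gap_le => x eta Ux Xeta.
  have [tau tr] := gap P lam P1 lam0 SE (vec x) eta h Xeta.
  move/le_trans; apply; have [f1 f2] := Uf x Ux tau tr.
  apply: (@le_trans _ _ (72 * K ^+ 13 * (4 * e))).
    by rewrite ler_pM2l ?mulr_gt0//; lra.
  by rewrite /e le_eqVlt; apply/orP; left; apply/eqP; field; rewrite gt_eqF.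
- move=> S1; split.
    move=> eps /andP[eps0 eps1]; split => //.
      by rewrite eballE; exact: measurable_qform_le.
    have /andP[V0 Vy] := @vol_eball_gt0_fin R n.
    rewrite divff; last by rewrite gt_eqF// fine_gt0// V0.
    by rewrite gerBl !mulr_ge0 ?expR_ge0 ?invr_ge0// ltW.
  move=> h; apply: sup_risk_gap_le => x eta Ux Xeta.
  have P1 : (1%:M : 'M[R]_n) *m 1%:M^T = 1%:M by rewrite trmx1 mulmx1.
  have SE : Sigma = fcalc 1%:M (fun=> 1) by rewrite (fcalc_cst P1).
  have [tau tr] := gap _ _ P1 (fun=> ltr01) SE (vec x) eta h Xeta.
  move/le_trans; apply.
  by rewrite /pred_weight /est_weight !fluctuation_cst// normr0 addr0 mulr0.
Qed.
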